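(* Let $X$ be one of the following groups: - $X=\mathbb{Z}(2^{m_1})\times\mathbb{Z}(2^{m_2})\times\cdots\times\mathbb{Z}(2^{m_k})$ with $m_1<m_2<\cdots<m_k$; - $X=\mathbb{Z}(2^\infty)$; - $X=\Delta_2$. Let $\alpha_j,\beta_j$, $j=1,2,\dots$, be topological automorphisms of $X$, and let $\xi_j$, $j=1,2,\dots$, be independent random variables taking values in $X$ with distributions $\mu_j$. Assume that: (i) the series $L_1=\sum_{j=1}^\infty\alpha_j\xi_j$ and $L_2=\sum_{j=1}^\infty\beta_j\xi_j$ converge in distribution; (ii) the linear forms $L_1$ and $L_2$ are independent. Then all $\mu_j$ are degenerate distributions, i.e., each $\mu_j$ is a Dirac mass at a point of $X$.
   Context: $\mathbb{Z}(m)$ is the multiplicative group of $m$th roots of unity (a finite cyclic group of order $m$, with the discrete topology). The exponents $m_i$ are nonnegative integers. $\mathbb{Z}(2^\infty)$ is the multiplicative group of all $2^n$th roots of unity, $n=0,1,2,\dots$, with the discrete topology. $\Delta_2$ is the compact additive group of $2$-adic integers. A topological automorphism of a topological group is a group automorphism that is also a homeomorphism. A distribution is a Borel probability measure. All groups are written additively in the linear forms. Convergence: for independent $X$-valued random variables $\eta_j$, the series $\sum_{j=1}^\infty\eta_j$ converges in distribution if there is an $X$-valued random variable $L$ such that the distributions of the partial sums $\sum_{j=1}^N\eta_j$ converge weakly to the distribution of $L$ as $N\to\infty$; one then writes $L=\sum_{j=1}^\infty\eta_j$. For the pair of linear forms, the joint distribution of $(L_1,L_2)$ on $X^2$ is understood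 to be the weak limit, as $N\to\infty$, of the distributions of the pairs of partial sums $\big(\sum_{j=1}^N\alpha_j\xi_j,\ \sum_{j=1}^N\beta_j\xi_j\big)$; in particular this limit is assumed to exist. Independence of $L_1$ and $L_2$ means that this joint distribution is the product of its marginals. *)

(* Defs.v *)
From HB Require Import structures.
From mathcomp Require Import all_boot all_order all_algebra.
From mathcomp Require Import all_classical all_reals all_analysis.
From mathcomp Require Import finmap complex.

Set Implicit Arguments.
Unset Strict Implicit.
Unset Printing Implicit Defensive.

Import Order.TTheory GRing.Theory Num.Theory.
Import numFieldTopology.Exports numFieldNormedType.Exports.

Local Open Scope classical_set_scope.
Local Open Scope ring_scope.

Section DiscreteZmodule.
Variable V : zmodType.

HB.instance Definition _ := GRing.Zmodule.copy (discrete_topology V) V.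

Lemma discrete_sub_continuous :
  continuous (fun x : discrete_topology V * discrete_topology V => x.1 - x.2).
Proof.
move=> [x y] U /nbhs_singleton /= Uxy.
exists ([set x], [set y]) => /= [|[? ?] /= [-> ->]//].
by split; exact: discrete_set1.
Qed.

HB.instance Definition _ :=
  PreTopologicalNmodule_isTopologicalZmodule.Build (discrete_topology V)
    discrete_sub_continuous.

End DiscreteZmodule.

Section ProductZmodule.
Variables (I : eqType) (V : I -> topologicalZmodType).

Local Notation T := (prod_topology V).
Let add (x y : T) : T := fun i => x i + y i.
Let opp (x : T) : T := fun i => - x i.
Let zero : T := fun=> 0.

Let addA : associative add.
Proof.
by move=> x y z; apply: functional_extensionality_dep => i; exact: addrA.
Qed.
Let addC : commutative add.
Proof.
by move=> x y; apply: functional_extensionality_dep => i; exact: addrC.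
Qed.
Let add0 : left_id zero add.
Proof.
by move=> x; apply: functional_extensionality_dep => i; exact: add0r.
Qed.
Let addN : left_inverse zero opp add.
Proof.
by move=> x; apply: functional_extensionality_dep => i; exact: addNr.
Qed.

HB.instance Definition _ := GRing.isZmodule.Build T addA addC add0 addN.

Lemma continuous_prod_topology (S : topologicalType) (f : S -> T) :
  (forall i, continuous (fun s => f s i)) -> continuous f.
Proof.
move=> cf s; apply/cvg_sup => i.
apply: (@continuous_comp_initial _ _ _ (fun g : forall i, V i => g i)
  (f : S -> initial_topology (fun g : forall i, V i => g i))).
exact: cf.
Qed.

Lemma prod_sub_continuous : continuous (fun x : T * T => x.1 - x.2).
Proof.
have pc i : continuous (fun x : T => x i).
  exact: (@proj_continuous I (fun i => V i : topologicalType) i).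
apply: continuous_prod_topology => i [x y].
have c1 : z.1 i @[z --> (x, y)] --> x i.
  exact: (cvg_comp fst (fun t : T => t i) cvg_fst (pc i x)).
have c2 : z.2 i @[z --> (x, y)] --> y i.
  exact: (cvg_comp snd (fun t : T => t i) cvg_snd (pc i y)).
exact: (cvg_comp _ _ (cvg_pair c1 c2) (@sub_continuous (V i) (x i, y i))).
Qed.

HB.instance Definition _ :=
  PreTopologicalNmodule_isTopologicalZmodule.Build T prod_sub_continuous.

End ProductZmodule.

HB.instance Definition _ (U V : topologicalZmodType) :=
  Topological.on (U * V)%type.

(* Subgroups of the multiplicative group of F. *)
Record mulSubgroup (F : fieldType) := MulSubgroup {
  mulSubgroup_pred :> pred F;
  mulSubgroup0 : mulSubgroup_pred 0 = false;
  mulSubgroup1 : mulSubgroup_pred 1;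
  mulSubgroupM : forall x y, mulSubgroup_pred x -> mulSubgroup_pred y ->
        mulSubgroup_pred (x * y);
  mulSubgroupV : forall x, mulSubgroup_pred x -> mulSubgroup_pred x^-1
}.

(* The same group with its law written additively. *)
Definition additive (F : fieldType) (G : mulSubgroup F) := {x : F | G x}.

Section Additive.
Variables (F : fieldType) (G : mulSubgroup F).

HB.instance Definition _ := SubChoice.on (additive G).

Let ne0 (x : F) : G x -> x != 0.
Proof. by apply: contraTneq => ->; rewrite mulSubgroup0. Qed.

Let add (x y : additive G) : additive G :=
  Sub (val x * val y) (mulSubgroupM (valP x) (valP y)).
Let opp (x : additive G) : additive G := Sub (val x)^-1 (mulSubgroupV (valP x)).
Let zero : additive G := Sub 1 (mulSubgroup1 G).

Let addA : associative add.
Proof. by move=> x y z; apply: val_inj; rewrite !SubK mulrA. Qed.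
Let addC : commutative add.
Proof. by move=> x y; apply: val_inj; rewrite !SubK mulrC. Qed.
Let add0 : left_id zero add.
Proof. by move=> x; apply: val_inj; rewrite !SubK mul1r. Qed.
Let addN : left_inverse zero opp add.
Proof.
by move=> x; apply: val_inj; rewrite !SubK mulVf// ne0//; exact: valP.
Qed.

HB.instance Definition _ :=
  GRing.isZmodule.Build (additive G) addA addC add0 addN.

End Additive.

Section Z2.
Variable R : realType.
Local Notation C := R[i].

Let unity2_neq0 n : (2 ^ n).-unity_root (0 : C) = false.
Proof.
apply/negbTE/unity_rootP => /eqP.
by rewrite expr0n expn_eq0 /= eq_sym oner_eq0.
Qed.
Let unity2_1 n : (2 ^ n).-unity_root (1 : C).
Proof. by apply/unity_rootP; rewrite expr1n. Qed.
Let unity2_mul n (x y : C) : (2 ^ n).-unity_root x -> (2 ^ n).-unity_root y ->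
  (2 ^ n).-unity_root (x * y).
Proof.
move=> /unity_rootP x1 /unity_rootP y1; apply/unity_rootP.
by rewrite exprMn x1 y1 mulr1.
Qed.
Let unity2_inv n (x : C) : (2 ^ n).-unity_root x -> (2 ^ n).-unity_root x^-1.
Proof. by move=> /unity_rootP x1; apply/unity_rootP; rewrite exprVn x1 invr1. Qed.
Let unity2_le m n (x : C) : (m <= n)%N ->
  (2 ^ m).-unity_root x -> (2 ^ n).-unity_root x.
Proof.
move=> mn /unity_rootP x1; apply/unity_rootP.
by rewrite -(subnKC mn) expnD exprM x1 expr1n.
Qed.

Definition roots_pow2 (n : nat) : mulSubgroup C :=
  @MulSubgroup C (fun z => (2 ^ n).-unity_root z)
    (unity2_neq0 n) (unity2_1 n) (@unity2_mul n) (@unity2_inv n).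

Let infty_pred : pred C :=
  fun z => `[< exists n, (2 ^ n).-unity_root z >].
Let infty0 : infty_pred 0 = false.
Proof. by apply/asboolPn => -[n]; rewrite unity2_neq0. Qed.
Let infty1 : infty_pred 1.
Proof. by apply/asboolP; exists 0%N; exact: unity2_1. Qed.
Let inftyM x y : infty_pred x -> infty_pred y -> infty_pred (x * y).
Proof.
move=> /asboolP[m xm] /asboolP[n yn]; apply/asboolP; exists (maxn m n).
by apply: unity2_mul; [apply: unity2_le xm|apply: unity2_le yn];
  rewrite ?leq_maxl ?leq_maxr.
Qed.
Let inftyV x : infty_pred x -> infty_pred x^-1.
Proof. by move=> /asboolP[m xm]; apply/asboolP; exists m; exact: unity2_inv. Qed.

Definition roots_pow2_infty : mulSubgroup C :=
  @MulSubgroup C (fun z => `[< exists n, (2 ^ n).-unity_root z >])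
    infty0 infty1 inftyM inftyV.

Definition Z_pow2 (n : nat) : topologicalZmodType :=
  discrete_topology (additive (roots_pow2 n)).

Definition Z_pow2_infty : topologicalZmodType :=
  discrete_topology (additive roots_pow2_infty).

Definition prod_Z_pow2 (k : nat) (m : 'I_k -> nat) : topologicalZmodType :=
  prod_topology (fun i => Z_pow2 (m i)).

End Z2.

Section TwoAdic.

Definition Z2_tower : topologicalZmodType :=
  prod_topology (fun n : nat => discrete_topology 'Z_(2 ^ n.+1)).

(* The 2-adic integers as the projective limit of the groups Z/2^(n+1), where
   (a : nat)%:R is the reduction of a : 'Z_(2 ^ n.+2) modulo 2 ^ n.+1. *)
Definition coherent : {pred Z2_tower} :=
  fun x => `[< forall n, x n = (x n.+1 : 'Z_(2 ^ n.+2))%:R :> 'Z_(2 ^ n.+1) >].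

Let redD n (a b : 'Z_(2 ^ n.+2)) :
  (a + b)%R%:R = a%:R + b%:R :> 'Z_(2 ^ n.+1).
Proof.
have gt1 k : (1 < 2 ^ k.+1)%N by rewrite -[1%N](expn0 2) ltn_exp2l.
rewrite -natrD; apply: ord_inj; rewrite !val_Zp_nat//=.
by rewrite modn_dvdm// Zp_cast// dvdn_exp2l.
Qed.

Lemma coherent_zmod_closed : zmod_closed coherent.
Proof.
split; first by apply/asboolP => n.
move=> x y /asboolP cx /asboolP cy; apply/asboolP => n.
have yx : ((x - y) n.+1 : 'Z_(2 ^ n.+2)) + y n.+1 = x n.+1.
  exact: (@subrK 'Z_(2 ^ n.+2) (y n.+1) (x n.+1)).
have := redD ((x - y) n.+1) (y n.+1); rewrite yx -cx -cy => xE.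
apply: (@addIr 'Z_(2 ^ n.+1) (y n)); rewrite -xE.
exact: (@subrK 'Z_(2 ^ n.+1) (y n) (x n)).
Qed.

HB.instance Definition _ := GRing.isZmodClosed.Build Z2_tower coherent
  coherent_zmod_closed.

Let Delta2_sub := {x : Z2_tower | x \in coherent}.
Definition Delta2 := initial_topology (val : Delta2_sub -> Z2_tower).

HB.instance Definition _ := SubChoice.copy Delta2 Delta2_sub.
HB.instance Definition _ := Topological.on Delta2.
HB.instance Definition _ := [SubChoice_isSubZmodule of Delta2 by <:].

Lemma Delta2_sub_continuous : continuous (fun x : Delta2 * Delta2 => x.1 - x.2).
Proof.
apply: (@continuous_comp_initial _ _ _ (val : Delta2_sub -> Z2_tower)) => -[x y].
have cv := @initial_continuous Delta2_sub Z2_tower val.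
have c1 : val z.1 @[z --> (x, y)] --> val x.
  exact: (cvg_comp fst val cvg_fst (cv x)).
have c2 : val z.2 @[z --> (x, y)] --> val y.
  exact: (cvg_comp snd val cvg_snd (cv y)).
exact: (cvg_comp _ _ (cvg_pair c1 c2) (@sub_continuous Z2_tower (val x, val y))).
Qed.

HB.instance Definition _ :=
  PreTopologicalNmodule_isTopologicalZmodule.Build Delta2 Delta2_sub_continuous.

End TwoAdic.

(* Not restricted to topologicalZmodType: the library reserves that structure
   on pairs for topological vector spaces, and the Borel sets of X * X are
   needed below. *)
Section Borel.
Variable T : PreTopologicalZmodule.type.

Definition borel : Type := T.

HB.instance Definition _ := Choice.copy borel T.
(* The library attaches sigma-algebras to pointed types only. *)
HB.instance Definition _ := isPointed.Build borel (0 : T).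
HB.instance Definition _ := Measurable.copy borel
  (g_sigma_algebraType (@open T : set (set borel))).

End Borel.

Definition topological_automorphism (X : topologicalZmodType) (f : X -> X) :=
  {morph f : x y / x + y} /\
  exists g : X -> X, [/\ cancel f g, cancel g f, continuous f & continuous g].

Section Probability.
Context {R : realType} {d : measure_display} {Omega : measurableType d}.
Variable P : probability Omega R.

Definition mutually_independent (X : topologicalZmodType)
    (xi : nat -> {RV P >-> borel X}) :=
  forall (J : {fset nat}) (B : nat -> set (borel X)),
    (forall j, measurable (B j)) ->
    P (\bigcap_(j in [set` J]) xi j @^-1` B j) =
    (\prod_(j <- J) P (xi j @^-1` B j))%E.

(* Weak convergence to nu of the distributions of the random elements S_n: the
   integral of f with respect to the distribution of S_n is written
   \int[P]_w f (S_n w). *)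
Definition cvg_in_distribution (T : PreTopologicalZmodule.type)
    (S : nat -> Omega -> T) (nu : probability (borel T) R) :=
  forall f : T -> R, continuous f -> (exists M, forall x, `|f x| <= M) ->
    (\int[P]_w f (S n w))%R @[n --> \oo] --> (\int[nu]_x f x)%R.

Definition partial_sums (X : topologicalZmodType) (eta : nat -> Omega -> X) :
    nat -> Omega -> X :=
  fun n w => \sum_(j < n) eta j w.

Definition series_cvg_in_distribution (X : topologicalZmodType)
    (eta : nat -> Omega -> X) :=
  exists nu, cvg_in_distribution (partial_sums eta) nu.

Definition product_of_marginals (X : topologicalZmodType)
    (nu : probability (borel (X * X)%type) R) :=
  forall A B : set (borel X), measurable A -> measurable B ->
    nu (A `*` B) = (nu (A `*` setT) * nu (setT `*` B))%E.

Definition independent_series (X : topologicalZmodType)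
    (eta zeta : nat -> Omega -> X) :=
  exists2 nu : probability (borel (X * X)%type) R,
    cvg_in_distribution
      (fun n w => (partial_sums eta n w, partial_sums zeta n w)) nu &
    product_of_marginals nu.

Definition degenerate (X : topologicalZmodType) (mu : set (borel X) -> \bar R) :=
  exists x : borel X, forall A, measurable A -> mu A = \d_x A.

End Probability.

Inductive two_group (R : realType) : topologicalZmodType -> Prop :=
| Two_group_finite (k : nat) (m : 'I_k -> nat) :
    (0 < k)%N -> {homo m : i j / (i < j)%N >-> (i < j)%N} ->
    two_group R (prod_Z_pow2 R m)
| Two_group_infty : two_group R (Z_pow2_infty R)
| Two_group_adic : two_group R Delta2.

(* Main.v *)
(* If every xi_j lies almost surely in a coset of an open subgroup K and H has
   index at most 2 in K, both stable under automorphisms, then automorphisms act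
   trivially on K / H, so that L_1 - L_2 is constant modulo H. Being independent,
   L_1 and L_2 are then themselves constant modulo H, and a sum of independent
   terms is never less spread out than one of its terms, so each xi_j lies almost
   surely in a coset of H. Each of the three groups has a chain of characteristic
   subgroups with steps of index at most 2 shrinking to 0, which starts from X
   itself, except for Z(2^oo), where it can only start from X[2^n].

   For Z(2^oo) one therefore has to find n such that every xi_j lies in a coset of
   F = X[2^n]. Choose n with L_1 and L_2 in F with probability > 7/8. Center the
   xi_j at their most likely cosets and let p_j be the probability of a defect
   (centered xi_j outside F). The centered partial sums S_k, T_k stay in F with
   probability > 7/8, and a single defect puts both of them outside F; hence
   P(S_k, T_k not in F) >= (5/8) sum_{j<k} p_j, while P(S_k not in F) and
   P(T_k not in F) are at most min(1/8, sum_{j<k} p_j). In the limit independence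
   turns the first probability into the product of the two others, so that
   sum_j p_j = 0. *)

Require Import Defs.
From mathcomp Require Import all_boot all_order all_algebra.
From mathcomp Require Import all_classical all_reals all_analysis.
From mathcomp Require Import finmap lra complex.

Set Implicit Arguments.
Unset Strict Implicit.
Unset Printing Implicit Defensive.

Import Order.TTheory GRing.Theory Num.Theory.
Import numFieldTopology.Exports numFieldNormedType.Exports.

Local Open Scope classical_set_scope.
Local Open Scope ring_scope.

(** * Characteristic open subgroups and their cosets *)

(** [U] is a union of cosets of [H]. An arbitrary group [V] is allowed so that the notion also
    covers pairs, with cosets of the square of [H] in [X * X]. *)
Definition saturated (V : zmodType) (H U : set V) :=
  forall x y, H (x - y) -> U x -> U y.

(** By [char_open] every union of cosets is clopen, so that its probability passes to weak limits.
    By [char_count] there are countably many cosets, so that events split over them by countable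
    additivity. *)
Record characteristic_open (X : topologicalZmodType) (H : set X) : Prop :=
  CharacteristicOpen {
    char0 : H 0;
    charB : forall x y, H x -> H y -> H (x - y);
    char_open : open H;
    char_count : exists c : nat -> X, forall x, exists n, H (x - c n);
    char_aut : forall f, topological_automorphism f -> forall x, H x -> H (f x)
  }.

Lemma aut_sub (X : topologicalZmodType) (f : X -> X) :
  topological_automorphism f -> forall x y, f (x - y) = f x - f y.
Proof.
move=> [fD _] x y; apply: (addIr (f y)).
by rewrite -fD !subrK.
Qed.

Lemma aut_inv (X : topologicalZmodType) (f : X -> X) :
  topological_automorphism f ->
  exists2 g, topological_automorphism g & cancel f g /\ cancel g f.
Proof.
move=> [fD [g [fg gf cf cg]]]; exists g => //; split.
  by move=> x y; rewrite -[in LHS](gf x) -[in LHS](gf y) -fD fg.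
by exists f.
Qed.

Section CosetCalculus.
Variables (X : topologicalZmodType) (H : set X) (chH : characteristic_open H).

Lemma charN x : H x -> H (- x).
Proof. by move=> Hx; rewrite -sub0r; apply: (charB chH) => //; exact: (char0 chH). Qed.

Lemma charD x y : H x -> H y -> H (x + y).
Proof. by move=> Hx /charN Hy; rewrite -(opprK y); exact: (charB chH). Qed.

Lemma char_subC x y : H (x - y) -> H (y - x).
Proof. by move=> /charN; rewrite opprB. Qed.

Lemma char_sub_trans y x z : H (x - y) -> H (y - z) -> H (x - z).
Proof. by move=> xy /(charD xy); rewrite addrA subrK. Qed.

Lemma char_subB x y x' y' : H (x - y) -> H (x' - y') -> H ((x - x') - (y - y')).
Proof. by move=> h h'; rewrite opprD addrACA -opprD; exact: (charB chH). Qed.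

Lemma char_autP f x y : topological_automorphism f -> H (f x - f y) <-> H (x - y).
Proof.
move=> af; rewrite -aut_sub//; split => [|/(char_aut chH af)//].
have [g ag [fg _]] := aut_inv af.
by move=> /(char_aut chH ag); rewrite fg.
Qed.

Definition coset a : set X := [set x | H (x - a)].

Lemma coset_saturated a : saturated H (coset a).
Proof. by move=> x y /char_subC xy; exact: char_sub_trans. Qed.

Lemma saturatedC (V : zmodType) (K U : set V) : (forall x y, K (x - y) -> K (y - x)) ->
  saturated K U -> saturated K (~` U).
Proof. by move=> KC sU x y xy nUx Uy; apply: nUx; apply: sU Uy; exact: KC. Qed.

Lemma nbhs_coset x : nbhs x [set y | H (x - y)].
Proof.
have : x - z.2 @[z --> (x, x)] --> x - x.
  exact: (cvg_comp _ _ (cvg_pair (cvg_cst x) cvg_snd) (@sub_continuous X (x, x))).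
move=> /(_ H); rewrite subrr => /(_ (open_nbhs_nbhs (conj (char_open chH) (char0
  chH)))).
move=> [[A B] /= [Ax Bx] sAB]; apply: filterS Bx => y By.
by apply: (sAB (x, y)); split => //=; exact: nbhs_singleton.
Qed.

Lemma saturated_open (U : set X) : saturated H U -> open U.
Proof.
move=> sU; rewrite openE => x Ux; rewrite /interior.
by apply: filterS (nbhs_coset x) => y xy; exact: sU Ux.
Qed.

Lemma saturated2_open (U : set (X * X)) : saturated (H `*` H) U -> open U.
Proof.
move=> sU; rewrite openE => -[x y] Ux; rewrite /interior.
exists ([set z | H (x - z)], [set z | H (y - z)]); first by split; exact: nbhs_coset.
by move=> [x' y'] [/= xx' yy']; apply: sU Ux.
Qed.

Lemma saturated2C (U : set (X * X)) :
  saturated (H `*` H) U -> saturated (H `*` H) (~` U).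
Proof. by apply: saturatedC => x y [/char_subC ? /char_subC ?]. Qed.

Lemma saturated_setX (A B : set X) : saturated H A -> saturated H B ->
  saturated (H `*` H) (A `*` B).
Proof. by move=> sA sB [x y] [x' y'] [/= xx' yy'] [/= Ax By]; split;
  [exact: sA Ax|exact: sB By]. Qed.

Lemma saturated_setT : saturated H setT.
Proof. by []. Qed.

Definition coset_rep : nat -> X := sval (cid (char_count chH)).

(* Empty when an earlier representative lies in the same coset. *)
Definition atom (n : nat) : set X :=
  coset (coset_rep n) `\` \bigcup_(m in [set m | (m < n)%N]) coset (coset_rep m).

Lemma atom_saturated n : saturated H (atom n).
Proof.
move=> x y xy [cx nx]; split; first exact: coset_saturated cx.
by move=> [m mn cy]; apply: nx; exists m => //; apply: coset_saturated cy;
  exact: char_subC.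
Qed.

Lemma atom_coset n x : atom n x -> H (x - coset_rep n).
Proof. by case. Qed.

Lemma atom_inj n m x : atom n x -> atom m x -> n = m.
Proof.
move=> [cn nn] [cm nm]; case: (ltngtP n m) => // lt.
  by case: nm; exists n.
by case: nn; exists m.
Qed.

Lemma atom_cover x : exists n, atom n x.
Proof.
have ex : exists n, `[< coset (coset_rep n) x >].
  by have [n Hn] := svalP (cid (char_count chH)) x; exists n; apply/asboolP.
case: (ex_minnP ex) => n /asboolP cn nmin; exists n; split => //.
by move=> [m /= mn /asboolP cm]; have := nmin m cm; rewrite leqNgt mn.
Qed.

End CosetCalculus.

(** * Independence of partial sums *)

Section Independence.
Context {R : realType} {d : measure_display} {Omega : measurableType d}.
Variables (P : probability Omega R) (X : topologicalZmodType).
Variable xi : nat -> Omega -> X.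
Hypothesis xi_meas : forall j (A : set X), open A -> measurable (xi j @^-1` A).

(** [E] is independent of the terms from index [k] on, tested on open boxes. Keeping the whole tail,
    and not only [xi k], is what makes an induction on [k] possible. *)
Definition indep_tail (k : nat) (E : set Omega) :=
  measurable E /\ forall n (B : nat -> set X), (forall j, open (B j)) ->
    P (E `&` \big[setI/setT]_(k <= j < n) xi j @^-1` B j) =
    (P E * \prod_(k <= j < n) P (xi j @^-1` B j))%E.

Lemma indep_tail_set0 k : indep_tail k set0.
Proof. by split => // n B _; rewrite set0I measure0 mul0e. Qed.

Lemma indep_tail_step k E (B : set X) : indep_tail k E -> open B ->
  indep_tail k.+1 (E `&` xi k @^-1` B) /\
  P (E `&` xi k @^-1` B) = (P E * P (xi k @^-1` B))%E.
Proof.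
move=> [mE iE] oB.
have PE : P (E `&` xi k @^-1` B) = (P E * P (xi k @^-1` B))%E.
  by have := iE k.+1 (fun=> B) (fun=> oB); rewrite !big_nat1.
split => //; split; first by apply: measurableI => //; exact: xi_meas.
move=> n B' oB'; have [kn|nk] := ltnP k n; last first.
  by rewrite !big_geq// ?setIT ?mule1// leqW.
(* Putting [B] at index [k] turns both factors into a single box that starts at [k], to which the
   hypothesis on [E] applies. *)
pose B'' j := if j == k then B else B' j.
have eqB j : (k.+1 <= j < n)%N -> B' j = B'' j.
  by move=> /andP[kj _]; rewrite /B'' gtn_eqF.
rewrite (_ : \big[_/_]_(_ <= _ < _) _ = \big[setI/setT]_(k.+1 <= j < n) xi j @^-1`
  B'' j);
  last by apply: eq_big_nat => j /eqB ->.
rewrite [in RHS](_ : (\prod_(_ <= _ < _) _)%E =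
    (\prod_(k.+1 <= j < n) P (xi j @^-1` B'' j))%E);
  last by apply: eq_big_nat => j /eqB ->.
have B''k : B = B'' k by rewrite /B'' eqxx.
rewrite PE B''k -muleA -setIA.
have := iE n B''; rewrite !(big_ltn kn); apply => j.
by rewrite /B''; case: ifP.
Qed.

(** Both sides of the product formula are countably additive in [E]. *)
Lemma indep_tail_bigcup k (E : nat -> set Omega) :
  (forall n, indep_tail k (E n)) -> trivIset setT E ->
  indep_tail k (\bigcup_n E n).
Proof.
move=> iE tE; split; first by apply: bigcupT_measurable => n; case: (iE n).
move=> n B oB; set T := \big[setI/setT]_(k <= j < n) _.
have mT : measurable T.
  by apply: bigsetI_measurable => j _; exact: xi_meas.
have pr0 : (0 <= \prod_(k <= j < n) P (xi j @^-1` B j))%E by exact: prode_ge0.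
have prfin : (\prod_(k <= j < n) P (xi j @^-1` B j) \is a fin_num)%E.
  by apply: prode_fin_num => j _; apply: fin_num_measure; exact: xi_meas.
rewrite setI_bigcupl measure_bigcup//=; last 2 first.
- by move=> j _; apply: measurableI => //; case: (iE j).
- exact: trivIset_setIr.
rewrite measure_bigcup//=; last by move=> j _; case: (iE j).
rewrite -(fineK prfin) muleC -nneseriesZl//; apply: eq_eseriesr => j _.
by rewrite (fineK prfin) muleC; case: (iE j) => _ ->.
Qed.

Hypothesis xi_indep : forall (J : {fset nat}) (B : nat -> set X),
  (forall j, open (B j)) ->
  P (\bigcap_(j in [set` J]) xi j @^-1` B j) =
  (\prod_(j <- J) P (xi j @^-1` B j))%E.

Lemma indep_tail0 : indep_tail 0 setT.
Proof.
split => // n B oB; rewrite setTI probability_setT mul1e.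
have := xi_indep [fset j in iota 0 n]%fset oB; rewrite bigcap_fset.
have pm : perm_eq [fset j in iota 0 n]%fset (index_iota 0 n).
  rewrite /index_iota subn0; apply: uniq_perm; rewrite ?fset_uniq ?iota_uniq//.
  by move=> j; rewrite inE.
by rewrite (perm_big _ pm)/= [in RHS](perm_big _ pm).
Qed.

Variables (H : set X) (chH : characteristic_open H).
Variables (alpha beta : nat -> X -> X).
Hypothesis aut_alpha : forall j, topological_automorphism (alpha j).
Hypothesis aut_beta : forall j, topological_automorphism (beta j).

Local Notation S := (partial_sums (fun j w => alpha j (xi j w))).
Local Notation T := (partial_sums (fun j w => beta j (xi j w))).

(** Induction on [k]. On the event that [xi k] lies in a given atom, the last terms of both sums are
    constant modulo [H], so the event is a saturated condition on the previous sums together with a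
    condition on [xi k] alone; these pieces are disjoint. *)
Lemma indep_tail_sums k (U : set (X * X)) : saturated (H `*` H) U ->
  indep_tail k [set w | U (S k w, T k w)].
Proof.
elim: k U => [|k IH] U sU.
  have [U0|U0] := pselect (U (0, 0)).
    rewrite (_ : [set _ | _] = setT); first exact: indep_tail0.
    by apply/seteqP; split => // w _ /=; rewrite /partial_sums !big_ord0.
  rewrite (_ : [set _ | _] = set0); first exact: indep_tail_set0.
  by apply/seteqP; split => // w /=; rewrite /partial_sums !big_ord0.
pose c := coset_rep chH.
(* [U] translated back by the contribution of the [n]-th representative. *)
pose V n : set (X * X) := [set p | U (p.1 + alpha k (c n), p.2 + beta k (c n))].
have sV n : saturated (H `*` H) (V n).
  by move=> [x y] [x' y'] [/= hx hy]; apply: sU; split => /=;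
    rewrite opprD addrACA subrr addr0.
rewrite (_ : [set _ | _] =
    \bigcup_n ([set w | V n (S k w, T k w)] `&` xi k @^-1` atom chH n)).
  apply: indep_tail_bigcup => [n|].
    apply: (indep_tail_step (IH _ (sV n)) _).1.
    by apply: (saturated_open chH); exact: atom_saturated.
  move=> n m _ _ [w [[_ an] [_ am]]]; exact: atom_inj an am.
have key n w : atom chH n (xi k w) ->
    U (S k.+1 w, T k.+1 w) <-> V n (S k w, T k w).
  move=> /atom_coset hn; rewrite /partial_sums !big_ord_recr/= /V/=.
  have ha : H (alpha k (xi k w) - alpha k (c n)) by apply/(char_autP chH).
  have hb : H (beta k (xi k w) - beta k (c n)) by apply/(char_autP chH).
  by split; apply: sU; split => /=; rewrite opprD addrACA subrr add0r//;
    exact: (char_subC chH).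
apply/seteqP; split => w /=.
  move=> Uw; have [n an] := atom_cover chH (xi k w).
  by exists n => //; split => //; apply/(key _ _ an).
by move=> [n _ [Vn an]]; apply/(key _ _ an).
Qed.

End Independence.

(** * Concentration on cosets *)

Lemma add_sub_shift (V : zmodType) (s u a v : V) :
  s + u - a = (s - (a - v)) + (u - v).
Proof. by rewrite opprB addrACA [v - a - v]addrAC subrr sub0r. Qed.

(** * Elementary estimates for real-valued probabilities *)

Section RealProbability.
Context {R : realType} {d : measure_display} {Omega : measurableType d}.
Variable P : probability Omega R.
Implicit Types A B : set Omega.

Definition pr A : R := fine (P A).

Lemma prE A : measurable A -> (pr A)%:E = P A.
Proof. by move=> mA; rewrite /pr fineK// fin_num_measure. Qed.

Lemma pr_ge0 A : 0 <= pr A.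
Proof. exact: fine_ge0. Qed.

Lemma prT : pr setT = 1.
Proof. by rewrite /pr probability_setT. Qed.

Lemma pr0 : pr set0 = 0.
Proof. by rewrite /pr measure0. Qed.

Lemma pr_le A B : measurable A -> measurable B -> A `<=` B -> pr A <= pr B.
Proof.
by move=> mA mB AB; rewrite -lee_fin !prE//; apply: le_measure => //; exact: mem_set.
Qed.

Lemma pr_le1 A : measurable A -> pr A <= 1.
Proof. by move=> mA; rewrite -lee_fin prE// probability_le1. Qed.

Lemma prC A : measurable A -> pr (~` A) = 1 - pr A.
Proof.
move=> mA; apply: EFin_inj; rewrite prE; last exact: measurableC.
by rewrite probability_setC// -prE.
Qed.

Lemma prU A B : measurable A -> measurable B -> A `&` B = set0 ->
  pr (A `|` B) = pr A + pr B.
Proof.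
move=> mA mB AB; apply: EFin_inj; rewrite EFinD !prE//; last exact: measurableU.
by rewrite measureU.
Qed.

Lemma prU_le A B : measurable A -> measurable B -> pr (A `|` B) <= pr A + pr B.
Proof.
move=> mA mB; rewrite -lee_fin EFinD !prE//; last exact: measurableU.
exact: measureU2.
Qed.

(** Serves to identify cosets: two cosets of total mass above 1 share a point, hence are equal. *)
Lemma pr_meet A B : measurable A -> measurable B -> 1 < pr A + pr B ->
  exists w, A w /\ B w.
Proof.
move=> mA mB AB; apply: contrapT => nAB.
suff : pr (A `|` B) <= 1 by rewrite prU// ?leNgt ?AB//; apply/seteqP; split =>
  // w [Aw Bw]; apply: nAB; exists w.
exact/pr_le1/measurableU.
Qed.

Lemma prI_ge A B : measurable A -> measurable B -> pr A + pr B - 1 <= pr (A `&` B).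
Proof.
move=> mA mB; have := prU_le (measurableC mA) (measurableC mB).
rewrite -setCI !prC//; last exact: measurableI.
by lra.
Qed.

Lemma pr_setI1 A B : measurable A -> measurable B -> pr B = 1 -> pr (A `&` B) = pr A.
Proof.
move=> mA mB B1; have mAB := measurableI _ _ mA mB.
have := prI_ge mA mB; have := pr_le mAB mA (@subIsetl _ A B).
by rewrite B1; lra.
Qed.

(** The union has probability [\sum_n P (E n) * P (F n)], with weights of sum at most 1, so it
    cannot exceed a common bound of the [P (F n)]. *)
Lemma pr_mix (E F : nat -> set Omega) t :
  (forall n, measurable (E n)) -> (forall n, measurable (F n)) ->
  trivIset setT E -> (forall n, P (E n `&` F n) = (P (E n) * P (F n))%E) ->
  0 <= t -> t < pr (\bigcup_n (E n `&` F n)) -> exists n, t < pr (F n).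
Proof.
move=> mE mF tE indep t0 tU; apply: contrapT => nex.
have Ft n : (P (F n) <= t%:E)%E.
  by rewrite -prE// lee_fin leNgt; apply/negP => tF; apply: nex; exists n.
suff : pr (\bigcup_n (E n `&` F n)) <= t by rewrite leNgt tU.
have mEF n : measurable (E n `&` F n) by exact: measurableI.
rewrite -lee_fin prE; last exact: bigcupT_measurable.
rewrite measure_bigcup//=; last exact: trivIset_setIr.
apply: (@le_trans _ _ (\sum_(0 <= n <oo | n \in setT) (t%:E * P (E n)))%E).
  apply: lee_nneseries => // n _; rewrite indep muleC.
  exact: lee_wpmul2r.
rewrite nneseriesZl//.
rewrite -measure_bigcup//= -[leRHS]mule1; apply: lee_wpmul2l => //.
by apply: probability_le1; exact: bigcupT_measurable.
Qed.

Lemma pr_cover (E : nat -> set Omega) : (forall n, measurable (E n)) ->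
  (forall w, exists n, E n w) -> exists n, 0 < pr (E n).
Proof.
move=> mE cE; apply: contrapT => nex.
have E0 n : P (E n) = 0%E.
  rewrite -prE//; congr EFin; apply/eqP; rewrite eq_le pr_ge0 andbT leNgt.
  by apply/negP => h; apply: nex; exists n.
have : P.-negligible (\bigcup_n E n).
  by apply: negligible_bigcup => n; apply/(negligibleP P (mE n)); exact: E0.
rewrite (_ : \bigcup_n E n = setT); last by apply/seteqP; split => // w _;
  have [n En] := cE w; exists n.
move=> /(negligibleP P measurableT) PT0; have : P setT = 0%E by exact: PT0.
by rewrite probability_setT => -[] /eqP; rewrite oner_eq0.
Qed.

End RealProbability.

(** * Passing from concentrated sums to concentrated terms *)

Section Concentration.
Context {R : realType} {d : measure_display} {Omega : measurableType d}.
Variables (P : probability Omega R) (X : topologicalZmodType).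
Variable xi : nat -> Omega -> X.
Hypothesis xi_meas : forall j (A : set X), open A -> measurable (xi j @^-1` A).
Hypothesis xi_indep : forall (J : {fset nat}) (B : nat -> set X),
  (forall j, open (B j)) ->
  P (\bigcap_(j in [set` J]) xi j @^-1` B j) =
  (\prod_(j <- J) P (xi j @^-1` B j))%E.
Variables (H : set X) (chH : characteristic_open H).
Variable alpha : nat -> X -> X.
Hypothesis aut_alpha : forall j, topological_automorphism (alpha j).

Local Notation S := (partial_sums (fun j w => alpha j (xi j w))).
Local Notation S_in k A := [set w | A (S k w)].
Local Notation xi_in k A := (xi k @^-1` A).

Lemma coset_open a : open (coset H a).
Proof. by apply: (saturated_open chH); exact: coset_saturated. Qed.

Lemma eq_coset a b : H (a - b) -> coset H a = coset H b.
Proof.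
move=> ab; apply/seteqP; split => x xa; apply: (char_sub_trans chH xa) => //.
exact: (char_subC chH).
Qed.

Lemma coset0 : coset H 0 = H.
Proof. by apply/seteqP; split => x; rewrite /coset/= subr0. Qed.

Lemma indep_tail_sum k A : saturated H A -> indep_tail P xi k (S_in k A).
Proof.
move=> sA; have := indep_tail_sums xi_meas xi_indep chH aut_alpha aut_alpha k
  (saturated_setX sA (@saturated_setT _ H)).
by rewrite (_ : [set w | (A `*` setT) (S k w, S k w)] = S_in k A)//; apply/seteqP;
  split => w//= -[].
Qed.

Lemma sum_meas k A : saturated H A -> measurable (S_in k A).
Proof. by move=> /(indep_tail_sum k)[]. Qed.

Lemma prob_sum_indep k A B : saturated H A -> open B ->
  P (S_in k A `&` xi_in k B) = (P (S_in k A) * P (xi_in k B))%E.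
Proof. by move=> sA oB; case: (indep_tail_step xi_meas (indep_tail_sum k sA) oB). Qed.

Lemma sumS k w : S k.+1 w = S k w + alpha k (xi k w).
Proof. by rewrite /partial_sums big_ord_recr. Qed.

(** [S k.+1] is a sum of two independent summands. Split over the atoms of one of them, the event
    becomes a mixture of events that the other lies in some coset, and a mixture above [t] has a
    component above [t]. *)
Lemma concentration_step k a t : 0 <= t -> t < pr P (S_in k.+1 (coset H a)) ->
  (exists b, t < pr P (S_in k (coset H b))) /\
  (exists b, t < pr P (xi_in k (coset H b))).
Proof.
move=> t0 tS; pose c := coset_rep chH.
have oatom n : open (atom chH n).
  by apply: (saturated_open chH); exact: atom_saturated.
have satc b : saturated H (coset H b) by exact: coset_saturated.
split.
(* Here the atom of [xi k] is fixed. *)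
- pose F n := S_in k (coset H (a - alpha k (c n))).
  have [|||n|||n tF] := @pr_mix _ _ _ P (fun n => xi_in k (atom chH n)) F t.
  + by move=> n; exact: xi_meas.
  + by move=> n; exact: sum_meas.
  + by move=> n m _ _ [w [an am]]; exact: atom_inj an am.
  + by rewrite setIC prob_sum_indep// muleC.
  + exact: t0.
  + rewrite (_ : \bigcup_n _ = S_in k.+1 (coset H a))//.
    have key n w : atom chH n (xi k w) ->
        coset H a (S k.+1 w) <-> F n w.
      move=> /atom_coset hn; rewrite /F/= sumS /coset/=.
      have ha : H (alpha k (xi k w) - alpha k (c n)) by apply/(char_autP chH).
      have -> : S k w + alpha k (xi k w) - a =
        (S k w - (a - alpha k (c n))) + (alpha k (xi k w) - alpha k (c n)).
        exact: add_sub_shift.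
      split => [h|h]; last exact: (charD chH).
      by have := charB chH h ha; rewrite addrK.
    apply/seteqP; split => w /=; first by move=> [n _ [an Fn]]; apply/(key n).
    by move=> Sw; have [n an] := atom_cover chH (xi k w); exists n => //; split =>
      //; apply/(key n).
  + by exists (a - alpha k (c n)).
(* Here the atom of [S k] is fixed; the inverse [g] of [alpha k] carries the resulting coset of
   [alpha k (xi k)] back to one of [xi k]. *)
- have [g ag [fg gf]] := aut_inv (aut_alpha k).
  pose F n := xi_in k (coset H (g (a - c n))).
  have [|||n|||n tF] := @pr_mix _ _ _ P (fun n => S_in k (atom chH n)) F t.
  + by move=> n; apply: sum_meas; exact: atom_saturated.
  + by move=> n; apply: xi_meas; exact: coset_open.
  + by move=> n m _ _ [w [an am]]; exact: atom_inj an am.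
  + by rewrite prob_sum_indep//; [exact: atom_saturated|exact: coset_open].
  + exact: t0.
  + rewrite (_ : \bigcup_n _ = S_in k.+1 (coset H a))//.
    have key n w : atom chH n (S k w) ->
        coset H a (S k.+1 w) <-> F n w.
      move=> /atom_coset hn; rewrite sumS /coset/=.
      have hF : F n w <-> H (alpha k (xi k w) - (a - c n)).
        by rewrite -{1}(gf (a - c n)); split => h;
          apply/(char_autP chH _ _ (aut_alpha k)).
      have -> : S k w + alpha k (xi k w) - a =
        (alpha k (xi k w) - (a - c n)) + (S k w - c n).
        by rewrite [X in X - a]addrC; exact: add_sub_shift.
      split => [h|/hF h]; last exact: (charD chH).
      by apply/hF; have := charB chH h hn; rewrite addrK.
    apply/seteqP; split => w /=; first by move=> [n _ [an Fn]]; apply/(key n).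
    by move=> Sw; have [n an] := atom_cover chH (S k w); exists n => //; split => //;
      apply/(key n).
  + by exists (g (a - c n)).
Qed.

Lemma concentration k n a t : 0 <= t -> (k <= n)%N ->
  t < pr P (S_in n (coset H a)) -> exists b, t < pr P (S_in k (coset H b)).
Proof.
move=> t0; elim: n a => [|n IH] a.
  by rewrite leqn0 => /eqP ->; exists a.
rewrite leq_eqVlt => /predU1P[->|]; first by exists a.
by rewrite ltnS => kn tS; have [[b tb] _] := concentration_step t0 tS; exact: IH tb.
Qed.

Lemma summand_concentration k n a t : 0 <= t -> (k < n)%N ->
  t < pr P (S_in n (coset H a)) -> exists b, t < pr P (xi_in k (coset H b)).
Proof.
by move=> t0 kn tS; have [b tb] := concentration t0 kn tS; have [] :=
  concentration_step t0 tb.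
Qed.

(** Only one coset can have mass above 1/2. If its mass were below 1, the hypothesis taken at that
    mass would give a heavier coset, which would have to be the same one. *)
Lemma concentrated_degenerate j :
  (forall t, 0 <= t < 1 -> exists b, t < pr P (xi_in j (coset H b))) ->
  exists b, pr P (xi_in j (coset H b)) = 1.
Proof.
have mxi b : measurable (xi_in j (coset H b)) by apply: xi_meas; exact: coset_open.
move=> conc; have [|b hb] := conc 2^-1; first by lra.
exists b; apply/eqP; rewrite eq_le pr_le1//= leNgt; apply/negP => hb1.
have [|b' hb'] := conc (pr P (xi_in j (coset H b))); first by rewrite hb1 pr_ge0.
have gt1 : 1 < pr P (xi_in j (coset H b)) + pr P (xi_in j (coset H b')) by lra.
have [w [/= wb wb']] := pr_meet (mxi b) (mxi b') gt1.
have bb' : H (b - b').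
  by apply: (char_sub_trans chH _ wb'); exact: (char_subC chH).
by move: hb'; rewrite (eq_coset bb') ltxx.
Qed.

End Concentration.

(** * Independent linear forms *)

Lemma open_borel (T : PreTopologicalZmodule.type) (U : set T) :
  open U -> measurable (U : set (borel T)).
Proof. by move=> oU; apply: sub_gen_smallest. Qed.

Lemma continuous_indic_clopen (R : realType) (T : topologicalType) (U : set T) :
  open U -> open (~` U) -> continuous (\1_U : T -> R).
Proof.
move=> oU oU' x; change ((\1_U : T -> R) @ x --> (\1_U x : R)).
have [Ux|nUx] := pselect (U x).
  rewrite [X in _ --> X](_ : _ = (1 : R)); last by rewrite indicE mem_set.
  apply: (@cvg_trans _ ((cst (1 : R)) @ x)); last exact: cvg_cst.
  apply: near_eq_cvg; have := open_nbhs_nbhs (conj oU Ux).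
  by apply: filterS => y Uy; rewrite indicE mem_set.
rewrite [X in _ --> X](_ : _ = (0 : R)); last by rewrite indicE memNset.
apply: (@cvg_trans _ ((cst (0 : R)) @ x)); last exact: cvg_cst.
apply: near_eq_cvg; have := open_nbhs_nbhs (conj oU' nUx).
by apply: filterS => y Uy; rewrite indicE memNset.
Qed.

(** The indicator of a clopen set is bounded and continuous, hence an admissible test function. *)
Lemma cvg_pr_clopen (R : realType) d (Omega : measurableType d)
    (P : probability Omega R) (T : PreTopologicalZmodule.type)
    (W : nat -> Omega -> T) (nu : probability (borel T) R) (U : set T) :
  cvg_in_distribution P W nu -> open U -> open (~` U) ->
  (forall n, measurable [set w | U (W n w)]) ->
  pr P [set w | U (W n w)] @[n --> \oo] --> pr nu U.
Proof.
move=> cv oU oU' mU.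
have := cv _ (continuous_indic_clopen oU oU').
have bnd : exists M : R, forall x, `|\1_U x : R| <= M.
  by exists 1 => x; rewrite indicE; case: (_ \in _); rewrite ?normr1 ?normr0.
move=> /(_ bnd); rewrite /Rintegral integral_indic ?setIT//; last exact: open_borel.
rewrite [X in X n @[n --> _] --> _ -> _](_ : _ = fun n => pr P [set w | U (W n w)])//.
apply/funext => n; rewrite /pr -[in RHS](setIT [set w | _]) -integral_indic//.
Qed.

Lemma sub_sub_swap (V : zmodType) (p q r a : V) :
  (p - r) - (p - q - a) = q - (r - a).
Proof.
rewrite -(addrA p (- q)) opprD addrACA subrr add0r (opprB (- q)) opprK opprB.
by rewrite addrC (addrC a q) -addrA.
Qed.

Lemma sub_add_sub (V : zmodType) (s a t b c e : V) :
  (s + a) - (t + b) - (c + e) = (s - t - c) + (a - b - e).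
Proof. by rewrite (opprD t) (addrACA s) (opprD c) (addrACA (s - t)). Qed.

Section IndependentForms.
Context {R : realType} {d : measure_display} {Omega : measurableType d}.
Variables (P : probability Omega R) (X : topologicalZmodType).
Variable xi : nat -> Omega -> X.
Hypothesis xi_meas : forall j (A : set X), open A -> measurable (xi j @^-1` A).
Hypothesis xi_indep : forall (J : {fset nat}) (B : nat -> set X),
  (forall j, open (B j)) ->
  P (\bigcap_(j in [set` J]) xi j @^-1` B j) =
  (\prod_(j <- J) P (xi j @^-1` B j))%E.
Variables alpha beta : nat -> X -> X.
Hypothesis aut_alpha : forall j, topological_automorphism (alpha j).
Hypothesis aut_beta : forall j, topological_automorphism (beta j).

Local Notation S := (partial_sums (fun j w => alpha j (xi j w))).
Local Notation T := (partial_sums (fun j w => beta j (xi j w))).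
Local Notation xi_in k A := (xi k @^-1` A).

Variable nu : probability (borel (X * X)%type) R.
Hypothesis cvg_nu : cvg_in_distribution P (fun n w => (S n w, T n w)) nu.
Hypothesis prod_nu : product_of_marginals nu.

Definition concentrated (H : set X) :=
  forall j, exists x, pr P (xi_in j (coset H x)) = 1.

Section FixedSubgroup.
Variables (H : set X) (chH : characteristic_open H).

Lemma joint_meas n (U : set (X * X)) : saturated (H `*` H) U ->
  measurable [set w | U (S n w, T n w)].
Proof. by move=> /(indep_tail_sums xi_meas xi_indep chH aut_alpha aut_beta n)[]. Qed.

Lemma joint_cvg (U : set (X * X)) : saturated (H `*` H) U ->
  pr P [set w | U (S n w, T n w)] @[n --> \oo] --> pr nu U.
Proof.
move=> sU; apply: cvg_pr_clopen => //.
- exact: (saturated2_open chH).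
- by apply: (saturated2_open chH); exact: (saturated2C chH).
- by move=> n; exact: joint_meas.
Qed.

Lemma joint_borel (U : set (X * X)) : saturated (H `*` H) U ->
  measurable (U : set (borel (X * X)%type)).
Proof. by move=> sU; apply: open_borel; exact: (saturated2_open chH). Qed.

Lemma joint_indep (A B : set X) : saturated H A -> saturated H B ->
  pr nu (A `*` B) = pr nu (A `*` setT) * pr nu (setT `*` B).
Proof.
move=> sA sB; have sT := @saturated_setT _ H.
have mX C D : saturated H C -> saturated H D ->
    measurable (C `*` D : set (borel (X * X)%type)).
  by move=> sC sD; apply: joint_borel; exact: saturated_setX.
apply: EFin_inj; rewrite EFinM !prE; [|exact: mX|exact: mX|exact: mX].
by apply: prod_nu; apply: open_borel; exact: (saturated_open chH).
Qed.

Lemma saturated_left b : saturated (H `*` H) (coset H b `*` setT).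
Proof. by apply: saturated_setX => //; exact: coset_saturated. Qed.

Lemma saturated_right b : saturated (H `*` H) (setT `*` coset H b).
Proof. by apply: saturated_setX => //; exact: coset_saturated. Qed.

Lemma limit_left b t : t < pr nu (coset H b `*` setT) ->
  \forall n \near \oo, t < pr P [set w | coset H b (S n w)].
Proof.
move=> /(cvgr_gt _ (joint_cvg (saturated_left (b := b)))); apply: filterS => n.
by congr (_ < pr P _); apply/seteqP; split => w //=; case.
Qed.

Lemma limit_right b t : t < pr nu (setT `*` coset H b) ->
  \forall n \near \oo, t < pr P [set w | coset H b (T n w)].
Proof.
move=> /(cvgr_gt _ (joint_cvg (saturated_right (b := b)))); apply: filterS => n.
by congr (_ < pr P _); apply/seteqP; split => w //=; case.
Qed.

End FixedSubgroup.

(** The intersection of [K] and [H] has at most two cosets in [K]; an automorphism preserves it,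
    hence also its complement in [K]. *)
Lemma trivial_action (K H : set X) (f : X -> X) :
  characteristic_open K -> characteristic_open H ->
  (forall u v, K u -> K v -> ~ H u -> ~ H v -> H (u - v)) ->
  topological_automorphism f -> forall x, K x -> H (f x - x).
Proof.
move=> chK chH index2 af x Kx; have f0 : f 0 = 0 by have := aut_sub af 0 0;
  rewrite !subrr.
have [Hx|nHx] := pselect (H x).
  by apply: (charB chH) => //; exact: (char_aut chH).
apply: index2 => //; first exact: (char_aut chK).
by move=> Hfx; apply: nHx; rewrite -[x]subr0; apply/(char_autP chH _ _ af);
  rewrite f0 subr0.
Qed.

Lemma concentrated_index2 (K H : set X) :
  characteristic_open K -> characteristic_open H ->
  (forall u v, K u -> K v -> ~ H u -> ~ H v -> H (u - v)) ->
  concentrated K -> concentrated H.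
Proof.
move=> chK chH index2 conK.
pose x j := sval (cid (conK j)).
have xE j : pr P (xi_in j (coset K (x j))) = 1 by exact: svalP (cid (conK j)).
(* The pairs whose difference lies in the coset of [a] modulo [H]. *)
pose U a : set (X * X) := [set p | H (p.1 - p.2 - a)].
have sU a : saturated (H `*` H) (U a).
  move=> [p1 p2] [q1 q2] [/= h1 h2] hU.
  exact: (char_sub_trans chH (char_subC chH (char_subB chH h1 h2)) hU).
(* [S n - T n] is almost surely congruent to [c n]: since [alpha j] and [beta j] agree modulo [H] on
   [K], replacing [xi j] by [x j] does not change their difference modulo [H]. *)
pose c n := \sum_(j < n) (alpha j (x j) - beta j (x j)).
have mU n a : measurable [set w | U a (S n w, T n w)] by exact: (joint_meas chH).
have mK j : measurable (xi_in j (coset K (x j))).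
  by apply: xi_meas; exact: coset_open.
have Uc n : pr P [set w | U (c n) (S n w, T n w)] = 1.
  elim: n => [|n IH].
    rewrite -[RHS](prT P); congr pr; apply/seteqP; split => // w _ /=.
    by rewrite /U/= /c /partial_sums !big_ord0 !subr0; exact: (char0 chH).
  apply/eqP; rewrite eq_le pr_le1//= -{1}IH -(pr_setI1 (mU _ _) (mK n) (xE n)).
  apply: pr_le => //; first exact: measurableI.
  move=> w [/= Un Kn]; rewrite /U/= /c !sumS big_ord_recr/= sub_add_sub.
  apply: (charD chH) => //.
  rewrite opprD addrACA -opprD -!aut_sub//.
  have ha := trivial_action chK chH index2 (aut_alpha n) Kn.
  have hb := trivial_action chK chH index2 (aut_beta n) Kn.
  exact: (char_sub_trans chH ha (char_subC chH hb)).
(* The coset of [c n] may vary with [n], so no limit coset is tracked. For each fixed [a] the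
   probability is 0 or 1, and in the form p(1 - p) = 0 this survives the limit. *)
have U01 a n : pr P [set w | U a (S n w, T n w)] * (1 - pr P [set w | U a (S n w,
  T n w)]) = 0.
  have [ca|nca] := pselect (H (c n - a)).
    rewrite (_ : [set w | _] = [set w | U (c n) (S n w, T n w)]) ?Uc ?subrr ?mulr0//.
    apply/seteqP; split => w /= h; apply: (char_sub_trans chH h) => //.
    exact: (char_subC chH).
  suff -> : pr P [set w | U a (S n w, T n w)] = 0 by rewrite mul0r.
  apply/eqP; rewrite eq_le pr_ge0 andbT -(subrr 1) -{2}(Uc n) -prC//.
  apply: pr_le => //; first exact: measurableC.
  by move=> w /= ha hc; apply: nca; exact: (char_sub_trans chH (char_subC chH hc) ha).
have nuU01 a : pr nu (U a) = 0 \/ pr nu (U a) = 1.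
  have cu := joint_cvg chH (sU a).
  have cz : pr P [set w | U a (S n w, T n w)] * (1 - pr P [set w | U a (S n w, T n w)])
      @[n --> \oo] --> pr nu (U a) * (1 - pr nu (U a)).
    by apply: cvgM => //; apply: cvgB => //; exact: cvg_cst.
  have c0 : pr P [set w | U a (S n w, T n w)] * (1 - pr P [set w | U a (S n w, T n w)])
      @[n --> \oo] --> (0 : R).
    by rewrite (funext (U01 a)); exact: cvg_cst.
  have /eqP : pr nu (U a) * (1 - pr nu (U a)) = 0 by exact: (cvg_unique _ cz c0).
  by rewrite mulf_eq0 subr_eq0 => /orP[]/eqP; [left|right].
have sT := @saturated_setT _ H.
pose r := coset_rep chH.
have cover z : exists n, H (z - r n).
  by have [n /atom_coset] := atom_cover chH z; exists n.
(* Countably many sets [U a] cover all pairs, so one of them has positive limit probability, which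
   is then 1. *)
have [a Ua1] : exists a, pr nu (U a) = 1.
  have [||n] := @pr_cover _ _ _ nu (fun n => U (r n)).
  - by move=> n; exact: (joint_borel chH).
  - by move=> [p1 p2]; exact: cover.
  - by move=> pos; exists (r n); case: (nuU01 (r n)) => // U0; move: pos;
    rewrite U0 ltxx.
(* Take a coset [A] of positive mass q for the first form. As the difference of the forms is almost
   surely in the coset of [a], the first lies in [A] exactly when the second lies in [B];
   independence gives q = q * q, hence q = 1. *)
have [b b1] : exists b, pr nu (coset H b `*` setT) = 1.
  have sA b := coset_saturated chH (a := b).
  have [||n q0] := @pr_cover _ _ _ nu (fun n => coset H (r n) `*` setT).
  - by move=> n; apply: (joint_borel chH); exact: saturated_setX.
  - by move=> [p1 p2]; have [n hn] := cover p1; exists n.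
  set A := coset H (r n); pose B := coset H (r n - a).
  exists (r n).
  have mX C D : saturated H C -> saturated H D ->
      measurable (C `*` D : set (borel (X * X)%type)).
    by move=> sC sD; apply: (joint_borel chH); exact: saturated_setX.
  have mUa : measurable (U a : set (borel (X * X)%type)) by exact: (joint_borel chH).
  have AB p1 p2 : U a (p1, p2) -> A p1 <-> B p2.
    rewrite /U/= => Up; rewrite /B/coset/= -(sub_sub_swap p1).
    by split => [h|h]; [exact: (charB chH)|have := charD chH h Up; rewrite subrK].
  have mAT := mX _ _ (sA (r n)) sT.
  have mAB := mX _ _ (sA (r n)) (sA (r n - a)).
  have mTB := mX _ _ sT (sA (r n - a)).
  have Aq : pr nu (A `*` setT) = pr nu (A `*` B).
    rewrite -(pr_setI1 mAT mUa Ua1) -(pr_setI1 mAB mUa Ua1).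
    congr pr; apply/seteqP; split => -[p1 p2] [[/= Ap _] Up]; split => //; split => //=.
    exact/(AB _ _ Up).
  have Bq : pr nu (setT `*` B) = pr nu (A `*` B).
    rewrite -(pr_setI1 mTB mUa Ua1) -(pr_setI1 mAB mUa Ua1).
    congr pr; apply/seteqP; split => -[p1 p2] [[/= _ Bp] Up]; split => //; split => //=.
    exact/(AB _ _ Up).
  have := joint_indep chH (sA (r n)) (sA (r n - a)).
  rewrite -/A -/B Bq -Aq => q2; apply/eqP; rewrite -subr_eq0.
  have /eqP : pr nu (A `*` setT) * (pr nu (A `*` setT) - 1) = 0.
    by rewrite mulrBr mulr1 -q2 subrr.
  by rewrite mulf_eq0 gt_eqF.
(* For each t < 1, partial sums of large index, in particular one containing the term [j], put mass
   above [t] on the coset of [b], so [xi j] puts mass above [t] on some coset. *)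
move=> j; apply: (concentrated_degenerate xi_meas chH) => t /andP[t0 t1].
have [N _ hN] : \forall n \near \oo, t < pr P [set w | coset H b (S n w)].
  by apply: (limit_left chH); rewrite b1.
apply: (summand_concentration xi_meas xi_indep chH aut_alpha t0 (leq_maxr N j.+1)).
exact/hN/leq_maxl.
Qed.

(** * Partial sums centered at the likely cosets of the terms *)

Section Shifted.
Variables (H : set X) (chH : characteristic_open H) (x : nat -> X) (t : R).
Hypothesis t_lb : 7 / 8 <= t < 1.
Hypothesis xi_conc : forall j, t < pr P (xi_in j (coset H (x j))).

(* The shift that centers a partial sum is the sum of the shifts that center
   the terms, because two cosets of probability > 1/2 coincide. *)
Lemma sum_centered (gam : nat -> X -> X) :
  (forall j, topological_automorphism (gam j)) ->
  (forall k, exists b, t < pr P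
     [set w | coset H b (partial_sums (fun j w => gam j (xi j w)) k w)]) ->
  forall k, t < pr P [set w | coset H (\sum_(j < k) gam j (x j))
     (partial_sums (fun j w => gam j (xi j w)) k w)].
Proof.
move=> ag conc; have /andP[t78 t1] := t_lb; elim=> [|k IH].
  rewrite (_ : [set w | _] = setT) ?prT; first by lra.
  apply/seteqP; split => // w _ /=.
  by rewrite /coset/= /partial_sums !big_ord0 subrr; exact: (char0 chH).
have mS n b := sum_meas xi_meas xi_indep chH ag n (coset_saturated chH (a := b)).
have mK : measurable (xi_in k (coset H (x k))).
  by apply: xi_meas; exact: coset_open.
have [b hb] := conc k.+1.
set s := \sum_(j < k) _ in IH.
have ind : pr P ([set w | coset H s (partial_sums (fun j w => gam j (xi j w)) k w)]
    `&` xi_in k (coset H (x k))) =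
    pr P [set w | coset H s (partial_sums (fun j w => gam j (xi j w)) k w)] *
    pr P (xi_in k (coset H (x k))).
  apply: EFin_inj; rewrite EFinM !prE//; last exact: measurableI.
  apply: (prob_sum_indep xi_meas xi_indep chH ag); first exact: coset_saturated.
  exact: coset_open.
have gt1 : 1 < pr P ([set w | coset H s (partial_sums (fun j w => gam j (xi j w)) k w)]
    `&` xi_in k (coset H (x k))) +
    pr P [set w | coset H b (partial_sums (fun j w => gam j (xi j w)) k.+1 w)].
  rewrite ind; have xk := xi_conc k.
  set u := pr P _ in IH *; set v := pr P _ in xk *.
  (* The product of these two positive factors yields u * v > (7/8)^2, and (7/8)^2 + 7/8 > 1. *)
  have u0 : 0 < u - 7 / 8 by lra.
  have v0 : 0 < v - 7 / 8 by lra.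
  by have := mulr_gt0 u0 v0; lra.
have [w [[/= sw xw] bw]] := pr_meet (measurableI _ _ (mS _ _) mK) (mS _ _) gt1.
rewrite big_ord_recr/= (_ : coset H _ = coset H b)//.
apply: (eq_coset chH); apply: (char_sub_trans chH _ bw); apply: (char_subC chH).
rewrite sumS opprD addrACA; apply: (charD chH) => //.
exact/(char_autP chH).
Qed.

(** Union bound: a centered sum can leave [H] only if the previous centered sum or the last centered
    term does. *)
Lemma shifted_defect_le (gam : nat -> X -> X) :
  (forall j, topological_automorphism (gam j)) ->
  forall k, pr P [set w | ~ coset H (\sum_(j < k) gam j (x j))
     (partial_sums (fun j w => gam j (xi j w)) k w)] <=
  \sum_(j < k) pr P (~` xi_in j (coset H (x j))).
Proof.
move=> ag; elim=> [|k IH].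
  rewrite !big_ord0 (_ : [set w | _] = set0) ?pr0//.
  apply/seteqP; split => // w /=; apply.
  by rewrite /coset/= /partial_sums !big_ord0 subrr; exact: (char0 chH).
have mS n b := sum_meas xi_meas xi_indep chH ag n (coset_saturated chH (a := b)).
have mK : measurable (xi_in k (coset H (x k))).
  by apply: xi_meas; exact: coset_open.
rewrite [leRHS]big_ord_recr/=; apply: (le_trans _ (lerD IH (lexx _))).
apply: (le_trans _ (prU_le _ (measurableC (mS _ _)) (measurableC mK))).
apply: pr_le.
- exact: (measurableC (mS _ _)).
- exact: (measurableU _ _ (measurableC (mS _ _)) (measurableC mK)).
move=> w /= nS; apply: contrapT => /not_orP[/contrapT Sk /contrapT xk].
apply: nS; rewrite big_ord_recr/= /coset/= sumS opprD addrACA; apply: (charD chH) => //.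
exact/(char_autP chH).
Qed.

(** A sum of two elements of which exactly one lies in the subgroup [H] is outside [H]. *)
Lemma one_defect (gam : nat -> X -> X) k w :
  (forall j, topological_automorphism (gam j)) ->
  let D n := coset H (\sum_(j < n) gam j (x j)) (partial_sums (fun j w =>
    gam j (xi j w)) n w) in
  let E := coset H (x k) (xi k w) in
  (~ D k /\ E) \/ (D k /\ ~ E) -> ~ D k.+1.
Proof.
move=> ag D E h; rewrite /D /coset/= sumS big_ord_recr/= opprD addrACA => Dk1.
case: h => [[nDk /(char_autP chH _ _ (ag k)) Ek]|[Dk nE]].
  by apply: nDk; have := charB chH Dk1 Ek; rewrite addrK.
by apply/nE/(char_autP chH _ _ (ag k)); have := charB chH Dk1 Dk;
  rewrite [X in H X]addrC addKr.
Qed.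

End Shifted.

Lemma concentrated_tight (H : set X) : characteristic_open H ->
  7 / 8 < pr nu (H `*` setT) -> 7 / 8 < pr nu (setT `*` H) -> concentrated H.
Proof.
move=> chH HT TH; have cH := coset0 H.
have concS : \forall n \near \oo, 7 / 8 < pr P [set w | coset H 0 (S n w)].
  by apply: (limit_left chH); rewrite cH.
have concT : \forall n \near \oo, 7 / 8 < pr P [set w | coset H 0 (T n w)].
  by apply: (limit_right chH); rewrite cH.
have t0 : 0 <= 7 / 8 :> R by lra.
have t1 : 7 / 8 <= (7 / 8 : R) < 1 by lra.
have conS k : exists b, 7 / 8 < pr P [set w | coset H b (S k w)].
  have [n _ hn] := concS.
  exact: (concentration xi_meas xi_indep chH aut_alpha t0 (leq_maxr n k) (hn _
    (leq_maxl n k))).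
have conT k : exists b, 7 / 8 < pr P [set w | coset H b (T k w)].
  have [n _ hn] := concT.
  exact: (concentration xi_meas xi_indep chH aut_beta t0 (leq_maxr n k) (hn _
    (leq_maxl n k))).
have conxi k : exists b, 7 / 8 < pr P (xi_in k (coset H b)).
  have [n _ hn] := concS.
  exact: (summand_concentration xi_meas xi_indep chH aut_alpha t0
    (leq_maxr n k.+1) (hn _ (leq_maxl n k.+1))).
pose x k := sval (cid (conxi k)).
have xE k : 7 / 8 < pr P (xi_in k (coset H (x k))) by exact: svalP (cid (conxi k)).
have cS := sum_centered chH t1 xE aut_alpha conS.
have cT := sum_centered chH t1 xE aut_beta conT.
pose s k := \sum_(j < k) alpha j (x j).
pose r k := \sum_(j < k) beta j (x j).
(* [a], [b] and [e] measure the events that the centered [S k], the centered [T k], or both leave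
   [H]; [p] is the defect probability of one term. *)
pose a k := pr P [set w | ~ coset H (s k) (S k w)].
pose b k := pr P [set w | ~ coset H (r k) (T k w)].
pose e k := pr P [set w | ~ coset H (s k) (S k w) /\ ~ coset H (r k) (T k w)].
pose p k := pr P (~` xi_in k (coset H (x k))).
have satc c : saturated H (coset H c) := coset_saturated chH (a := c).
have satcC c : saturated H (~` coset H c).
  by apply: saturatedC (satc c); exact: (char_subC chH).
have mS n A (sA : saturated H A) := sum_meas xi_meas xi_indep chH aut_alpha n sA.
have mT n A (sA : saturated H A) := sum_meas xi_meas xi_indep chH aut_beta n sA.
have mK k : measurable (xi_in k (coset H (x k))).
  by apply: xi_meas; exact: coset_open.
have a_small k : a k < 1 / 8.
  rewrite /a (prC P (mS k _ (satc (s k)))); have := cS k; rewrite -/(s k); lra.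
have b_small k : b k < 1 / 8.
  rewrite /b (prC P (mT k _ (satc (r k)))); have := cT k; rewrite -/(r k); lra.
have p_ge0 k : 0 <= p k by exact: pr_ge0.
have a_ge0 k : 0 <= a k by exact: pr_ge0.
have b_ge0 k : 0 <= b k by exact: pr_ge0.
have a_le k : a k <= \sum_(j < k) p j by exact: (shifted_defect_le chH).
have b_le k : b k <= \sum_(j < k) p j by exact: (shifted_defect_le chH).
(* Each step adds at least p(1 - a - b - e) to [e], and e <= a < 1/8 and b < 1/8 leave 1 - 3/8 =
   5/8. *)
have e_ge k : 5 / 8 * \sum_(j < k) p j <= e k.
  elim: k => [|k IH]; first by rewrite big_ord0 mulr0; exact: pr_ge0.
  rewrite big_ord_recr/= mulrDr.
  pose N : set (X * X) := ~` coset H (s k) `*` ~` coset H (r k).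
  pose I : set (X * X) := coset H (s k) `*` coset H (r k).
  have sN : saturated (H `*` H) N by exact: saturated_setX.
  have sI : saturated (H `*` H) I by exact: saturated_setX.
  have mJ U (sU : saturated (H `*` H) U) := joint_meas chH k sU.
  have ind U B : saturated (H `*` H) U -> open B ->
      pr P ([set w | U (S k w, T k w)] `&` xi_in k B) =
      pr P [set w | U (S k w, T k w)] * pr P (xi_in k B).
    move=> sU oB; apply: EFin_inj; rewrite EFinM !prE.
    - exact: (indep_tail_step xi_meas
        (indep_tail_sums xi_meas xi_indep chH aut_alpha aut_beta k sU) oB).2.
    - exact: xi_meas.
    - exact: mJ.
    - by apply: measurableI; [exact: mJ|exact: xi_meas].
  have oK : open (coset H (x k)) by exact: coset_open.
  have oKC : open (~` coset H (x k)) by exact: (saturated_open chH).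
  (* Two disjoint ways for both sums to be outside after step [k]: both were outside and there is no
     defect, or both were inside and there is one. *)
  pose E1 := [set w | N (S k w, T k w)] `&` xi_in k (coset H (x k)).
  pose E2 := [set w | I (S k w, T k w)] `&` xi_in k (~` coset H (x k)).
  have mE1 : measurable E1 by apply: measurableI; [exact: mJ|exact: xi_meas].
  have mE2 : measurable E2 by apply: measurableI; [exact: mJ|exact: xi_meas].
  have E12 : pr P (E1 `|` E2) <= e k.+1.
    apply: pr_le; first exact: measurableU.
      exact: (joint_meas chH k.+1 (saturated_setX (satcC (s k.+1)) (satcC (r k.+1)))).
    by move=> w [] [[/= Sk Tk] xk]; split; apply: (@one_defect _ chH _ _ _ w) => //;
      [left|left|right|right].
  have pE1 : pr P E1 = e k * (1 - p k).
    by rewrite /E1 ind// -/(e k) /p prC// opprB addrC subrK.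
  have pE2 : (1 - a k - b k) * p k <= pr P E2.
    rewrite /E2 ind//; apply: ler_wpM2r => //.
    have := prI_ge P (mS k _ (satc (s k))) (mT k _ (satc (r k))).
    rewrite /a /b (prC P (mS k _ (satc (s k)))) (prC P (mT k _ (satc (r k)))).
    by rewrite (_ : _ `&` _ = [set w | I (S k w, T k w)])//; lra.
  move: E12; rewrite prU//; last first.
    by apply/seteqP; split => // w [[[]]] /= ? ? ? [[]].
  have ea : e k <= a k.
    apply: pr_le; last by move=> w [].
      exact: (mJ _ sN).
    exact: (mS k _ (satcC (s k))).
  have := a_small k; have := b_small k => bs as_.
  have : 0 <= p k * (1 - a k - b k - e k - 5 / 8) by apply: mulr_ge0 => //; lra.
  by rewrite pE1; lra.
(* The bounds a <= q and b <= 1/8 give a * b <= q / 8, and 5/8 - 1/8 = 1/2. *)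
have key k : (\sum_(j < k) p j) / 2 <= e k - a k * b k.
  have := e_ge k; have := a_le k; have := b_le k; have := a_small k; have := b_small k.
  have := a_ge0 k; have := b_ge0 k.
  set q := \sum_(j < k) p j => *.
  have : a k * b k <= q * (1 / 8) by apply: ler_pM => //; exact: ltW.
  by lra.
suff p0 j : p j = 0.
  move=> j; exists (x j); have := p0 j; rewrite /p prC//; lra.
(* The deviation from independence of the events that [S n] and [T n] leave [H]. It is taken without
   centers so that the limit applies; it tends to 0. *)
pose u n := pr P [set w | (~` H `*` ~` H) (S n w, T n w)] -
  pr P [set w | (~` H `*` setT) (S n w, T n w)] *
  pr P [set w | (setT `*` ~` H) (S n w, T n w)].
have sHC : saturated H (~` H) by have := satcC 0; rewrite cH.
have sT := @saturated_setT _ H.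
have u0 : u n @[n --> \oo] --> (0 : R).
  have -> : 0 = pr nu (~` H `*` ~` H) -
    pr nu (~` H `*` setT) * pr nu (setT `*` ~` H) :> R.
    by rewrite (joint_indep chH)// subrr.
  by apply: cvgB; [|apply: cvgM]; apply: (joint_cvg chH); exact: saturated_setX.
have n_large : \forall n \near \oo, p j / 2 <= u n.
  near=> n.
  have jn : (j < n)%N by near: n; exact: nbhs_infty_gt.
  have /(eq_coset chH) sn0 : H (s n - 0).
    have gt1 : 1 < pr P [set w | coset H 0 (S n w)] + pr P [set w | coset H (s n) (S
      n w)].
      have : 7 / 8 < pr P [set w | coset H 0 (S n w)] by near: n.
      by have := cS n; rewrite -/(s n); lra.
    have [w [/= w0 ws]] := pr_meet (mS n _ (satc 0)) (mS n _ (satc (s n))) gt1.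
    exact: (char_sub_trans chH (char_subC chH ws) w0).
  have /(eq_coset chH) rn0 : H (r n - 0).
    have gt1 : 1 < pr P [set w | coset H 0 (T n w)] + pr P [set w | coset H (r n) (T
      n w)].
      have : 7 / 8 < pr P [set w | coset H 0 (T n w)] by near: n.
      by have := cT n; rewrite -/(r n); lra.
    have [w [/= w0 ws]] := pr_meet (mT n _ (satc 0)) (mT n _ (satc (r n))) gt1.
    exact: (char_sub_trans chH (char_subC chH ws) w0).
  have -> : u n = e n - a n * b n.
    rewrite /e /a /b sn0 rn0 cH; congr (_ - pr P _ * pr P _);
      by apply/seteqP; split => w //= -[].
  apply: le_trans (key n); rewrite ler_pM2r//.
  by rewrite (bigD1 (Ordinal jn))//= lerDl sumr_ge0.
apply/eqP; rewrite eq_le p_ge0 andbT leNgt; apply/negP => pos.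
have pos2 : 0 < p j / 2 by lra.
near \oo => n.
have : u n < p j / 2 by near: n; exact: (cvgr_lt _ u0).
by rewrite ltNge; apply/negP; rewrite negbK; near: n.
Unshelve. all: by end_near. Qed.

End IndependentForms.

(** * Degeneracy *)

Section Degeneracy.
Context {R : realType} {d : measure_display} {Omega : measurableType d}.
Variables (P : probability Omega R) (X : topologicalZmodType).

Lemma concentrated_setT (xi : nat -> Omega -> X) : concentrated P xi setT.
Proof. by move=> j; exists 0; rewrite -[RHS](prT P); congr pr; apply/seteqP; split. Qed.

(** Outside a null set [N] all values of [xi j] are congruent modulo every [H n], hence equal, as
    the [H n] intersect in 0. *)
Lemma degenerate_of_concentrated (xi : nat -> {RV P >-> borel X})
    (H : nat -> set X) :
  (forall n, characteristic_open (H n)) ->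
  (forall x, (forall n, H n x) -> x = 0) ->
  (forall n, concentrated P xi (H n)) ->
  forall j, degenerate (distribution P (xi j)).
Proof.
move=> chH H0 conH j.
pose y n := sval (cid (conH n j)).
have yE n : pr P (xi j @^-1` coset (H n) (y n)) = 1 by exact: svalP (cid (conH n j)).
have mxi n a : measurable (xi j @^-1` coset (H n) a).
  by apply: measurable_funPTI; apply: open_borel; exact: coset_open.
pose N := \bigcup_n (xi j @^-1` ~` coset (H n) (y n)).
have mN : measurable N by apply: bigcupT_measurable => n;
  exact: (measurableC (mxi n (y n))).
have PN : P N = 0%E.
  have : P.-negligible N.
    apply: negligible_bigcup => n.
    have mC := measurableC (mxi n (y n)); apply/(negligibleP P mC).
    have P0 : P (~` (xi j @^-1` coset (H n) (y n))) = 0%E.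
      by rewrite -(prE P mC) prC// yE subrr.
    exact: P0.
  by move=> /(negligibleP P mN).
have [w0 nNw0] : exists w0, ~ N w0.
  apply: contrapT => nex; have : P setT = 0%E.
    by rewrite -PN; congr (P _); apply/seteqP; split => // w _; apply: contrapT =>
      nN; apply: nex; exists w.
  by rewrite probability_setT => -[] /eqP; rewrite oner_eq0.
have eq0 w : ~ N w -> xi j w = xi j w0.
  move=> nNw; apply/eqP; rewrite -subr_eq0; apply/eqP; apply: H0 => n.
  have inC v : ~ N v -> coset (H n) (y n) (xi j v).
    by move=> nNv; apply: contrapT => nc; apply: nNv; exists n.
  exact: (char_sub_trans (chH n) (inC w nNw) (char_subC (chH n) (inC w0 nNw0))).
exists (xi j w0) => A mA; rewrite /distribution /pushforward diracE.
have mxA : measurable (xi j @^-1` A). by exact: measurable_funPTI.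
have null B : measurable B -> B `<=` N -> P B = 0%E.
  move=> mB BN; apply/eqP; rewrite -measure_le0 -PN le_measure//; exact: mem_set.
have [Aw|nAw] := pselect (A (xi j w0)).
  rewrite mem_set//=; apply/eqP; rewrite -[P _]fineK ?fin_num_measure//.
  have := prC P mxA; rewrite /pr null//; last first.
  - by move=> w nAw; apply: contrapT => /eq0 e; apply: nAw; rewrite /preimage/= e.
  - exact: measurableC.
  by move=> /esym /eqP; rewrite subr_eq0 => /eqP <-.
rewrite memNset//=; apply: null => // w Aw; apply: contrapT => /eq0 e.
by apply: nAw; rewrite -e.
Qed.

End Degeneracy.

Lemma countable_quotient (X : zmodType) (H : set X) (g : X -> nat) :
  (forall x y, g x = g y -> H (x - y)) ->
  exists c : nat -> X, forall x, exists n, H (x - c n).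
Proof.
(* The representative of a code that is not attained is the default 0. *)
move=> gH; exists (fun n => xget 0 [set y | g y = n]) => x; exists (g x).
by apply: gH; rewrite (xgetPex 0 (ex_intro (fun y => g y = g x) x erefl)).
Qed.

Lemma aut_mulrn (X : topologicalZmodType) (f : X -> X) n x :
  topological_automorphism f -> f (x *+ n) = f x *+ n.
Proof.
move=> [fD _]; elim: n => [|n IH]; last by rewrite !mulrS fD IH.
by apply: (addrI (f 0)); rewrite -fD !mulr0n !addr0.
Qed.

(** * Roots of unity *)

Lemma mulrn_pow2_le (V : zmodType) c n (x : V) :
  (c <= n)%N -> x *+ (2 ^ c) = 0 -> x *+ (2 ^ n) = 0.
Proof. by move=> cn xc; rewrite -(subnKC cn) expnD mulrnA xc mul0rn. Qed.

Lemma val_addD (F : fieldType) (G : mulSubgroup F) (x y : Defs.additive G) :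
  val (x + y) = val x * val y.
Proof. by []. Qed.

Lemma val_addN (F : fieldType) (G : mulSubgroup F) (x : Defs.additive G) :
  val (- x) = (val x)^-1.
Proof. by []. Qed.

Lemma val_addMn (F : fieldType) (G : mulSubgroup F) (x : Defs.additive G) n :
  val (x *+ n) = val x ^+ n.
Proof. by elim: n => [|n IH]; rewrite ?mulr0n// mulrS val_addD IH exprS. Qed.

Lemma mulrn_eq0_roots (F : fieldType) (G : mulSubgroup F) (x : Defs.additive G) n :
  x *+ n = 0 <-> val x ^+ n = 1.
Proof.
split => [/(congr1 val)|h]; first by rewrite val_addMn.
by apply: val_inj; rewrite val_addMn.
Qed.

Section RootsOfUnity.
Variable R : realType.
Local Notation C := R[i].

Lemma roots_pow2_mulrn m (x : Defs.additive (roots_pow2 R m)) : x *+ (2 ^ m) = 0.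
Proof. by apply/mulrn_eq0_roots/unity_rootP; exact: (valP x). Qed.

Lemma sqrt1_pow2 (n : nat) (x : C) : x ^+ (2 ^ n.+1)%N = 1 -> x ^+ (2 ^ n)%N <> 1 ->
  x ^+ (2 ^ n)%N = -1.
Proof.
rewrite expnSr exprM => /eqP; rewrite sqrf_eq1 => /orP[/eqP //|/eqP //].
Qed.

(** A complex square root of a 2^m-th root of unity is a 2^(m+1)-th root of unity, so it stays in
    the group. *)
Lemma roots_pow2_half m (x : Defs.additive (roots_pow2 R m.+1)) :
  x *+ (2 ^ m) = 0 -> exists y : Defs.additive (roots_pow2 R m.+1), x = y *+ 2.
Proof.
move=> /mulrn_eq0_roots x1; have sq := sqrtCK (val x).
have y1 : roots_pow2 R m.+1 (sqrtC (val x)).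
  by apply/unity_rootP; rewrite expnS exprM sq.
by exists (Sub (sqrtC (val x)) y1); apply: val_inj; rewrite val_addMn SubK sq.
Qed.

Lemma roots_pow2_killed_half m c (x : Defs.additive (roots_pow2 R m)) :
  (c < m)%N -> x *+ (2 ^ c) = 0 -> exists y : Defs.additive (roots_pow2 R m),
    x = y *+ 2.
Proof.
case: m x => [//|m] x; rewrite ltnS => cm xc; apply: roots_pow2_half.
exact: mulrn_pow2_le cm xc.
Qed.

(** In the group of order 2^(m+1), an element that is not a double has 2^m-th power -1; two such
    powers cancel in the quotient. *)
Lemma roots_pow2_index2 m (x y : Defs.additive (roots_pow2 R m)) :
  ~ (exists z : Defs.additive (roots_pow2 R m), x = z *+ 2) ->
  ~ (exists z : Defs.additive (roots_pow2 R m), y = z *+ 2) ->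
  exists z : Defs.additive (roots_pow2 R m), x - y = z *+ 2.
Proof.
case: m x y => [|m] x y nx ny.
  by case: nx; exists 0; have := roots_pow2_mulrn x; rewrite expn0 mulr1n mul0rn.
have pow z : ~ (exists t : Defs.additive (roots_pow2 R m.+1),
  z = t *+ 2) -> val z ^+ (2 ^ m)%N = -1.
  move=> nz; apply: sqrt1_pow2; first exact/mulrn_eq0_roots/roots_pow2_mulrn.
  by move=> z1; apply: nz; apply: roots_pow2_half; exact/mulrn_eq0_roots.
apply: roots_pow2_half; apply/mulrn_eq0_roots.
by rewrite val_addD val_addN exprMn exprVn !pow// divff// oppr_eq0 oner_eq0.
Qed.

Lemma pow2_roots_list n : exists s : seq C, forall x, x ^+ (2 ^ n)%N = 1 -> x \in s.
Proof.
have [s hs] := closed_field_poly_normal ('X^(2 ^ n) - 1 : {poly C}).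
exists s => x x1; have : root ('X^(2 ^ n) - 1) x by apply/rootP;
  rewrite !hornerE x1 subrr.
rewrite hs rootZ ?root_prod_XsubC// lead_coef_eq0.
by rewrite -size_poly_eq0 size_XnsubC// expn_gt0.
Qed.

(** Encodes the least [n] with x^(2^n) = 1 together with the position of [x] in a list containing
    all roots of that equation; 0 is a default for all other [x]. *)
Definition root_code (x : C) : nat :=
  if pselect (exists n, (x ^+ (2 ^ n)%N == 1)) is left h
  then choice.pickle (ex_minn h, index x (sval (cid (pow2_roots_list (ex_minn h)))))
    else 0%N.

Lemma root_code_inj n m (x y : C) : x ^+ (2 ^ n)%N = 1 -> y ^+ (2 ^ m)%N = 1 ->
  root_code x = root_code y -> x = y.
Proof.
move=> xn ym; rewrite /root_code; case: pselect => [hx|[]]; last by exists n; apply/eqP.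
case: pselect => [hy|[]]; last by exists m; apply/eqP.
case: (ex_minnP hx) => a /eqP xa _; case: (ex_minnP hy) => b /eqP yb _.
move=> /(pcan_inj choice.pickleK)[ab]; rewrite -ab in yb *.
move: (svalP (cid (pow2_roots_list a))); set s := sval _ => hs.
by move=> /(congr1 (nth 0 s)); rewrite !nth_index ?hs.
Qed.

End RootsOfUnity.

(** * Filtrations of the three groups *)

(** The condition on [u] and [v] says that the intersection of [K] and [H] has index at most 2 in
    [K]. [Q] stands for [concentrated P xi], which keeps the filtrations purely algebraic. *)
Definition index2_closed (X : topologicalZmodType) (Q : set X -> Prop) :=
  forall K H, characteristic_open K -> characteristic_open H ->
    (forall u v, K u -> K v -> ~ H u -> ~ H v -> H (u - v)) -> Q K -> Q H.

(** * The group Z(2^oo), filtered by the subgroups X[2^n] *)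

Section Prufer.
Variable R : realType.
Local Notation X := (Z_pow2_infty R).

Definition killed_by (n : nat) : set X := [set x | x *+ (2 ^ n) = 0].

Lemma killed_by_char n : characteristic_open (killed_by n).
Proof.
split.
- exact: mul0rn.
- by move=> x y xn yn; rewrite /killed_by/= mulrnBl xn yn subrr.
- exact: discrete_open.
- apply: (@countable_quotient X _ (fun x : X => root_code (val x))) => x y.
  have [[p hp] [q hq]] : (exists p, val x ^+ (2 ^ p) = 1) /\ (exists p,
    val y ^+ (2 ^ p) = 1).
    by split; [have /asboolP[p /unity_rootP h] :=
      valP x|have /asboolP[p /unity_rootP h] := valP y]; exists p.
  move=> /(root_code_inj hp hq) /val_inj ->; rewrite subrr; exact: mul0rn.
- move=> f af x xn; rewrite /killed_by/= -(aut_mulrn _ _ af) xn.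
  by have := aut_sub af 0 0; rewrite !subrr.
Qed.

Lemma killed_by_index2 n x y : killed_by n.+1 x -> killed_by n.+1 y ->
  ~ killed_by n x -> ~ killed_by n y -> killed_by n (x - y).
Proof.
move=> /mulrn_eq0_roots x1 /mulrn_eq0_roots y1 nx ny; apply/mulrn_eq0_roots.
have xN : val x ^+ (2 ^ n) = -1.
  by apply: sqrt1_pow2 => // h; apply: nx; exact/mulrn_eq0_roots.
have yN : val y ^+ (2 ^ n) = -1.
  by apply: sqrt1_pow2 => // h; apply: ny; exact/mulrn_eq0_roots.
by rewrite val_addD val_addN exprMn exprVn xN yN divff// oppr_eq0 oner_eq0.
Qed.

Lemma killed_by_cover x : exists n, killed_by n x.
Proof.
have /asboolP[p /unity_rootP h] := valP x; exists p; exact/mulrn_eq0_roots.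
Qed.

Lemma killed_by_descent (Q : set X -> Prop) n :
  index2_closed Q -> Q (killed_by n) -> Q (killed_by 0).
Proof.
move=> Qc; elim: n => // n IH Qn; apply: IH; apply: Qc Qn; try exact: killed_by_char.
exact: killed_by_index2.
Qed.

End Prufer.

(** * Finite products of cyclic 2-groups with distinct exponents *)

Section FiniteProduct.
Variables (R : realType) (k : nat) (m : 'I_k -> nat).
Hypothesis m_inj : injective m.
Local Notation X := (prod_Z_pow2 R m).

Lemma prod_mulrn (x : X) n i : (x *+ n) i = x i *+ n.
Proof. by elim: n => // n IH; rewrite !mulrS -IH. Qed.

Lemma prod_Z_pow2_open (A : set X) : open A.
Proof.
have o1 (x : X) : open [set x].
  have -> : [set x] = \big[setI/setT]_(i < k) ((fun y : X => y i) @^-1` [set x i]).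
    apply/seteqP; split => [y -> | y].
      by rewrite big_seq; elim/big_ind: _.
    rewrite -bigcap_seq => h; apply: functional_extensionality_dep => i.
    by apply: h; rewrite /= mem_index_enum.
  elim/big_ind: _ => [|B C|i _]; [exact: openT|exact: openI|].
  apply: open_comp; last exact: discrete_open.
  by move=> y _; exact: (@proj_continuous _ (fun i =>
    Z_pow2 R (m i) : topologicalType) i).
rewrite (_ : A = \bigcup_(x in A) [set x]); first by apply: bigcup_open.
by apply/seteqP; split => [x Ax|x [y Ay ->]//]; exists x.
Qed.

Lemma prod_code_inj : exists g : X -> nat, injective g.
Proof.
exists (fun x : X => choice.pickle [ffun i => root_code (val (x i))]).
move=> x y /(pcan_inj choice.pickleK) /ffunP xy.
apply: functional_extensionality_dep => i; apply: val_inj.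
have := xy i; rewrite !ffunE; apply: root_code_inj (m i) (m i) _ _ _ _;
  by apply/unity_rootP; exact: valP.
Qed.

(* H(a, b) = 2^(a+1) X + (2^a X)[2^b]; as b decreases from large values to 0
   these refine 2^a X > 2^(a+1) X to steps of index at most 2. *)
Definition fil (a b : nat) : set X := [set x | exists u v,
  x = u *+ (2 ^ a.+1) + v *+ (2 ^ a) /\ v *+ (2 ^ (a + b)) = 0].

Lemma fil_char a b : characteristic_open (fil a b).
Proof.
split.
- by exists 0, 0; rewrite !mul0rn addr0.
- move=> x y [u [v [-> v0]]] [u' [v' [-> v0']]]; exists (u - u'), (v - v').
  by rewrite !mulrnBl v0 v0' subrr opprD addrACA.
- exact: prod_Z_pow2_open.
- have [g g_inj] := prod_code_inj; apply: (@countable_quotient _ _ g) => x y /g_inj ->.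
  by rewrite subrr; exists 0, 0; rewrite !mul0rn addr0.
- move=> f af x [u [v [-> v0]]]; exists (f u), (f v).
  rewrite -!(aut_mulrn _ _ af) v0; case: (af) => fD _; rewrite fD; split => //.
  by have := aut_sub af 0 0; rewrite !subrr.
Qed.

(** Halve the coordinates that can be halved into [w]; then [v - w *+ 2] vanishes there and is
    killed by 2^(a+b) elsewhere. *)
Lemma fil_split a b (v : X) :
  (forall i, v i *+ (2 ^ (a + b)) = 0 \/ exists w : Z_pow2 R (m i), v i = w *+ 2) ->
  fil a b (v *+ (2 ^ a)).
Proof.
move=> hv.
pose w : X := fun i => if pselect (exists w : Z_pow2 R (m i), v i = w *+ 2) is left h
  then sval (cid h) else 0.
exists w, (v - w *+ 2); split.
  by rewrite mulrnBl -mulrnA -expnS addrC subrK.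
apply: functional_extensionality_dep => i; rewrite prod_mulrn.
change ((v i - (w *+ 2) i) *+ 2 ^ (a + b) = 0); rewrite prod_mulrn /w.
case: pselect => [h|nh]; first by rewrite -(svalP (cid h)) subrr mul0rn.
by rewrite mul0rn subr0; case: (hv i).
Qed.

(** By [fil_split] some coordinate of [v] is neither killed by 2^(a+b) nor a double. The first
    excludes m i <= a + b; the second excludes m i > a + b + 1, as [v] is killed by 2^(a+b+1). *)
Lemma fil_witness a b (u v : X) : v *+ (2 ^ (a + b.+1)) = 0 ->
  ~ fil a b (u *+ (2 ^ a.+1) + v *+ (2 ^ a)) ->
  exists2 i, m i = (a + b).+1 & ~ exists w : Z_pow2 R (m i), v i = w *+ 2.
Proof.
move=> v0 nf; apply: contrapT => nex; apply: nf.
have [u' [v' [e v0']]] : fil a b (v *+ (2 ^ a)).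
  apply: fil_split => i; apply: contrapT => /not_orP[nk nw]; apply: nex; exists i => //.
  apply/eqP; rewrite eqn_leq; apply/andP; split; rewrite leqNgt; apply/negP => lt.
    apply: nw; apply: (roots_pow2_killed_half lt).
    by have := congr1 (fun x : X => x i) v0; rewrite prod_mulrn addnS.
  apply: nk; apply: mulrn_pow2_le (roots_pow2_mulrn _); by rewrite -ltnS.
by exists (u + u'), v'; rewrite e addrA -mulrnDl.
Qed.

(** The exponents being distinct, both witnesses sit in the one coordinate with exponent a + b + 1.
    There the difference of two elements that are not doubles is a double, and all other coordinates
    are harmless for [fil_split]. *)
Lemma fil_index2 a b x y : fil a b.+1 x -> fil a b.+1 y ->
  ~ fil a b x -> ~ fil a b y -> fil a b (x - y).
Proof.
move=> [u [v [-> v0]]] [u' [v' [-> v0']]] nx ny.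
have [i mi nvi] := fil_witness v0 nx.
have [i' mi' nvi'] := fil_witness v0' ny.
have ii' : i' = i by apply: m_inj; rewrite mi mi'.
rewrite ii' in nvi'.
have [u2 [v2 [e v20]]] : fil a b ((v - v') *+ (2 ^ a)).
  apply: fil_split => i0; have [->|ne] := eqVneq i0 i.
    by right; exact: roots_pow2_index2.
  have vv0 : (v i0 - v' i0) *+ (2 ^ (a + b.+1)) = 0.
    rewrite mulrnBl -!prod_mulrn v0 v0'; exact: subrr.
  have [lt|] := ltnP (m i0) (a + b).+1.
    left; apply: mulrn_pow2_le (roots_pow2_mulrn (v i0 - v' i0)); by rewrite -ltnS.
  rewrite leq_eqVlt => /predU1P[eqm|lt]; last by right;
    apply: (roots_pow2_killed_half lt); rewrite -addnS.
  by case/eqP: ne; apply: m_inj; rewrite mi eqm.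
exists (u - u' + u2), v2; split=> //.
by rewrite opprD addrACA -!mulrnBl e addrA -mulrnDl.
Qed.

Lemma prod_mulrn_pow2 (x : X) n : (\sum_i m i <= n)%N -> x *+ (2 ^ n) = 0.
Proof.
move=> mn; apply: functional_extensionality_dep => i; rewrite prod_mulrn.
apply: mulrn_pow2_le (roots_pow2_mulrn (x i)); apply: leq_trans mn.
by rewrite (bigD1 i)//= leq_addr.
Qed.

(** 2 to the power [\sum_i m i] kills X, so [fil a (\sum_i m i)] is 2^a X. The second index descends
    to 0, where [fil a 0] is 2^(a+1) X, the top of the next level. *)
Lemma fil_descent (Q : set X -> Prop) n : index2_closed Q -> Q setT ->
  Q (fil n (\sum_i m i)).
Proof.
move=> Qc QT; have down a b : Q (fil a b) -> Q (fil a 0).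
  elim: b => // b IH Qb; apply: IH; apply: Qc Qb; try exact: fil_char.
  exact: fil_index2.
elim: n => [|a IH].
  rewrite (_ : fil _ _ = setT)//; apply/seteqP; split => // x _.
  exists 0, x; rewrite mul0rn add0r expn0; split => //; exact: prod_mulrn_pow2.
(* [fil a 0] lies in the next subgroup, so the index condition holds vacuously. *)
apply: Qc (down _ _ IH); try exact: fil_char.
move=> x y [u [v [-> v0]]] _ nH; exfalso; apply: nH; exists 0, u.
rewrite mul0rn add0r; rewrite addn0 in v0; rewrite v0 addr0; split => //.
by apply: prod_mulrn_pow2; rewrite leq_addl.
Qed.

Lemma fil_inter b x : (forall n, fil n b x) -> x = 0.
Proof.
move=> /(_ (\sum_i m i)%N) [u [v [-> _]]].
by rewrite !prod_mulrn_pow2 ?addr0.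
Qed.

End FiniteProduct.

(** * The 2-adic integers, filtered by the subgroups 2^n X *)

Section TwoAdicIntegers.

(** The residue of [x] modulo 2^(n+1), not a single binary digit. *)
Definition digits (x : Delta2) (n : nat) : nat := nat_of_ord (val x n : 'Z_(2 ^ n.+1)).

Lemma pow2_gt1 n : (1 < 2 ^ n.+1)%N.
Proof. by rewrite -[1%N](expn0 2) ltn_exp2l. Qed.

Lemma digits_lt x n : (digits x n < 2 ^ n.+1)%N.
Proof. by have := ltn_ord (val x n : 'Z_(2 ^ n.+1));
  rewrite [X in (_ < X)%N]Zp_cast ?pow2_gt1. Qed.

Lemma digitsS x n : digits x n = (digits x n.+1 %% 2 ^ n.+1)%N.
Proof.
have /asboolP/(_ n) h := valP x.
by rewrite /digits h val_Zp_nat ?pow2_gt1.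
Qed.

Lemma digits_mod x n k : digits x n = (digits x (n + k) %% 2 ^ n.+1)%N.
Proof.
elim: k => [|k IH]; first by rewrite addn0 modn_small// digits_lt.
by rewrite IH addnS digitsS modn_dvdm// dvdn_exp2l// ltnS leq_addr.
Qed.

Lemma digits_inj x y : (forall n, digits x n = digits y n) -> x = y.
Proof.
move=> xy; apply: val_inj; apply: functional_extensionality_dep => n.
exact: ord_inj (xy n).
Qed.

Lemma Z2_towerMn (y : Z2_tower) k n : (y *+ k) n = (y n : 'Z_(2 ^ n.+1)) *+ k.
Proof. by elim: k => // k IH; rewrite mulrS [RHS]mulrS -IH. Qed.

Lemma val_Delta2Mn (x : Delta2) k n :
  val (x *+ k) n = (val x n : 'Z_(2 ^ n.+1)) *+ k.
Proof.
by rewrite raddfMn Z2_towerMn.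
Qed.

Lemma digitsMn x k n : digits (x *+ k) n = (digits x n * k %% 2 ^ n.+1)%N.
Proof.
rewrite /digits val_Delta2Mn -{1}(natr_Zp (val x n : 'Z_(2 ^ n.+1))) -mulrnA.
by rewrite val_Zp_nat ?pow2_gt1.
Qed.

Lemma Delta2_halving x n : digits x n = 0%N -> exists z, x = z *+ (2 ^ n.+1).
Proof.
move=> xn.
have dv j : (2 ^ n.+1 %| digits x (j + n.+1))%N.
  by rewrite /dvdn addnS addnC -addnS -digits_mod xn.
(* Division by 2^(n+1) costs n + 1 places: the residue modulo 2^(j+n+2) determines the quotient
   modulo 2^(j+1). *)
pose q j := (digits x (j + n.+1) %/ 2 ^ n.+1)%N.
have q_lt j : (q j < 2 ^ j.+1)%N.
  by rewrite ltn_divLR ?expn_gt0// -expnD addSn; exact: digits_lt.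
pose zt : Z2_tower := fun j => (q j)%:R : 'Z_(2 ^ j.+1).
have ztE j : nat_of_ord (zt j : 'Z_(2 ^ j.+1)) = q j.
  by rewrite val_Zp_nat ?pow2_gt1// modn_small.
have czt : zt \in coherent.
  apply/asboolP => j; apply: ord_inj; rewrite ztE val_Zp_nat ?pow2_gt1// ztE.
  have e : digits x (j + n.+1) = ((q j.+1 %% 2 ^ j.+1) * 2 ^ n.+1)%N.
    by rewrite muln_modl -expnD (divnK (dv j.+1)) digitsS.
  by rewrite {1}/q e mulnK ?expn_gt0.
exists (Sub zt czt); apply: digits_inj => j; rewrite digitsMn.
have -> : digits (Sub zt czt) j = q j by rewrite /digits SubK ztE.
by rewrite /q divnK// -digits_mod.
Qed.

Lemma digitsB0 x y n : digits x n = digits y n -> digits (x - y) n = 0%N.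
Proof.
move=> /ord_inj e; rewrite /digits raddfB.
change (nat_of_ord ((val x n : 'Z_(2 ^ n.+1)) - val y n) = 0%N).
by rewrite e subrr.
Qed.

Definition multiples (n : nat) : set Delta2 := [set x | exists z, x = z *+ (2 ^ n)].

(** Divisibility is visibly preserved by automorphisms; a condition on one residue is visibly
    open. *)
Lemma multiplesE n : multiples n.+1 = [set x | digits x n = 0%N].
Proof.
apply/seteqP; split => [x [z ->]|x xn] /=; last exact: Delta2_halving.
by rewrite digitsMn modnMl.
Qed.

Lemma multiples0 : multiples 0 = setT.
Proof. by apply/seteqP; split => // x _; exists x; rewrite expn0. Qed.

Lemma digits_open n k : open [set x | digits x n = k].
Proof.
pose pn (x : Delta2) := (val x : Z2_tower) n.
apply: (@open_comp Delta2 (discrete_topology 'Z_(2 ^ n.+1)) pn [set z | nat_of_ord z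
  = k]);
  last exact: discrete_open.
move=> x _; apply: (@continuous_comp Delta2 Z2_tower _ val (fun y : Z2_tower => y n)).
  exact: initial_continuous.
exact: (@proj_continuous nat (fun n => discrete_topology 'Z_(2 ^ n.+1) :
  topologicalType) n).
Qed.

Lemma multiples_char n : characteristic_open (multiples n).
Proof.
split.
- by exists 0; rewrite mul0rn.
- by move=> x y [z ->] [z' ->]; exists (z - z'); rewrite mulrnBl.
- by case: n => [|n]; [rewrite multiples0; exact: openT|rewrite multiplesE;
  exact: digits_open].
- apply: (@countable_quotient _ _ (digits^~ n)) => x y xy.
  suff : multiples n.+1 (x - y).
    by move=> [z ->]; exists (z *+ 2); rewrite -mulrnA -expnS.
  by rewrite multiplesE /=; exact: digitsB0.
- by move=> f af x [z ->]; exists (f z); rewrite aut_mulrn.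
Qed.

(** The cofactors of 2^n in [x] and [y] are odd, so their difference is even. *)
Lemma multiples_index2 n x y : multiples n x -> multiples n y ->
  ~ multiples n.+1 x -> ~ multiples n.+1 y -> multiples n.+1 (x - y).
Proof.
move=> [u ->] [v ->] nu nv.
have odd z : ~ multiples n.+1 (z *+ (2 ^ n)) -> digits z 0 = 1%N.
  move=> nz; have := digits_lt z 0; case e : (digits z 0) => [|[]]// _.
  have : multiples 1 z by rewrite multiplesE.
  by move=> [t zt]; case: nz; exists t; rewrite zt -mulrnA -expnS.
have : multiples 1 (u - v).
  by rewrite multiplesE; apply: digitsB0; rewrite (odd _ nu) (odd _ nv).
by move=> [t uvt]; exists t; rewrite -mulrnBl uvt -mulrnA -expnS.
Qed.

Lemma multiples_inter x : (forall n, multiples n x) -> x = 0.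
Proof.
move=> h; apply: digits_inj => n; have := h n.+1; rewrite multiplesE/= => ->.
by have := char0 (multiples_char n.+1); rewrite multiplesE.
Qed.

Lemma multiples_descent (Q : set Delta2 -> Prop) n :
  index2_closed Q -> Q setT -> Q (multiples n).
Proof.
move=> Qc QT; elim: n => [|n IH]; first by rewrite multiples0.
by apply: Qc IH; [exact: multiples_char|exact: multiples_char|exact: multiples_index2].
Qed.

End TwoAdicIntegers.

(** * Conclusion *)

Lemma pr_exhaust (R : realType) d (T : measurableType d) (P : probability T R)
    (E : nat -> set T) t :
  (forall n, measurable (E n)) -> {homo E : n m / (n <= m)%N >-> n `<=` m} ->
  (forall x, exists n, E n x) -> t < 1 -> \forall n \near \oo, t < pr P (E n).
Proof.
move=> mE hE cE t1.
have ET : \bigcup_n E n = setT.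
  by apply/seteqP; split => // x _; have [n En] := cE x; exists n.
have mU : measurable (\bigcup_n E n) by exact: bigcupT_measurable.
have hE' : {homo E : n m / (n <= m)%N >-> (n <= m)%O}.
  by move=> n m nm; apply/subsetPset; exact: hE.
have cvE : (P \o E) n @[n --> \oo] --> 1%:E.
  by rewrite -(probability_setT P) -ET; exact: nondecreasing_cvg_mu.
by move/fine_cvgP : cvE => [_ cvE]; exact: (cvgr_gt _ cvE).
Qed.

Section Main.
Context {R : realType} {d : measure_display} {Omega : measurableType d}.
Variables (P : probability Omega R) (X : topologicalZmodType).
Variables (alpha beta : nat -> X -> X).
Hypothesis aut_alpha : forall j, topological_automorphism (alpha j).
Hypothesis aut_beta : forall j, topological_automorphism (beta j).
Variable xi : nat -> {RV P >-> borel X}.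
Hypothesis xi_indep : mutually_independent xi.
Variable nu : probability (borel (X * X)%type) R.
Hypothesis cvg_nu : cvg_in_distribution P
  (fun n w => (partial_sums (fun j w => alpha j (xi j w)) n w,
               partial_sums (fun j w => beta j (xi j w)) n w)) nu.
Hypothesis prod_nu : product_of_marginals nu.

Lemma RV_meas j (A : set X) : open A -> measurable (xi j @^-1` A).
Proof. by move=> oA; apply: measurable_funPTI; exact: open_borel. Qed.

Lemma RV_indep (J : {fset nat}) (B : nat -> set X) : (forall j, open (B j)) ->
  P (\bigcap_(j in [set` J]) xi j @^-1` B j) =
  (\prod_(j <- J) P (xi j @^-1` B j))%E.
Proof. by move=> oB; apply: xi_indep => j; exact: open_borel. Qed.

Lemma concentrated_index2_closed : index2_closed (concentrated P xi).
Proof.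
move=> K H chK chH index2.
exact: (concentrated_index2 RV_meas RV_indep aut_alpha aut_beta cvg_nu prod_nu chK
  chH index2).
Qed.

(** By continuity from below, both marginals of [nu] give some [H n] mass above 7/8, which is what
    [concentrated_tight] asks for. *)
Lemma concentrated_exhaust (H : nat -> set X) :
  (forall n, characteristic_open (H n)) ->
  {homo H : n m / (n <= m)%N >-> n `<=` m} -> (forall x, exists n, H n x) ->
  exists n, concentrated P xi (H n).
Proof.
move=> chH hH cH; have t1 : 7 / 8 < 1 :> R by lra.
have mH n (A B : set X) : saturated (H n) A -> saturated (H n) B ->
    measurable (A `*` B : set (borel (X * X)%type)).
  by move=> sA sB; apply: open_borel; apply: (saturated2_open (chH n));
    exact: saturated_setX.
have sH n : saturated (H n) (H n).
  by rewrite -[X in saturated _ X]coset0; exact: coset_saturated.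
have [N1 _ h1] : \forall n \near \oo, 7 / 8 < pr nu (H n `*` setT).
  apply: pr_exhaust => //.
  - by move=> n; exact: mH.
  - by move=> n m nm [x y] [/= Hx _]; split => //; exact: hH Hx.
  - by move=> [x y]; have [n Hx] := cH x; exists n.
have [N2 _ h2] : \forall n \near \oo, 7 / 8 < pr nu (setT `*` H n).
  apply: pr_exhaust => //.
  - by move=> n; exact: mH.
  - by move=> n m nm [x y] [/= _ Hy]; split => //; exact: hH Hy.
  - by move=> [x y]; have [n Hy] := cH y; exists n.
exists (maxn N1 N2).
apply: (concentrated_tight RV_meas RV_indep aut_alpha aut_beta cvg_nu prod_nu (chH _)).
  exact/h1/leq_maxl.
exact/h2/leq_maxr.
Qed.

End Main.

Theorem theorem4p1 (R : realType) (X : topologicalZmodType)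
  (hX : two_group R X)
  (alpha beta : nat -> X -> X)
  (halpha : forall j, topological_automorphism (alpha j))
  (hbeta : forall j, topological_automorphism (beta j))
  (d : measure_display) (Omega : measurableType d) (P : probability Omega R)
  (xi : nat -> {RV P >-> borel X})
  (hxi : mutually_independent xi)
  (hL1 : series_cvg_in_distribution P (fun j w => alpha j (xi j w)))
  (hL2 : series_cvg_in_distribution P (fun j w => beta j (xi j w)))
  (hL12 : independent_series P (fun j w => alpha j (xi j w))
            (fun j w => beta j (xi j w))) :
  forall j, degenerate (distribution P (xi j)).
Proof.
have [nu cvg_nu prod_nu] := hL12.
have Qc := concentrated_index2_closed halpha hbeta hxi cvg_nu prod_nu.
have QT := @concentrated_setT _ _ _ P X xi.
have exhaust := concentrated_exhaust halpha hbeta hxi cvg_nu prod_nu.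
clear hL1 hL2 hL12 cvg_nu prod_nu.
case: hX alpha beta halpha hbeta xi hxi nu Qc QT exhaust =>
  [k m _ mlt|  |] alpha' beta' _ _ xi' hxi' nu' Qc QT exhaust.
- have m_inj : injective m.
    move=> i i' mii; apply: ord_inj; case: (ltngtP i i') => // /mlt;
      by rewrite mii ltnn.
  apply: (@degenerate_of_concentrated _ _ _ _ _ _ (fun n => fil n (\sum_i m i))).
  + by move=> n; exact: fil_char.
  + exact: fil_inter.
  + by move=> n; exact: (fil_descent m_inj n Qc QT).
- have [n cn] : exists n, concentrated P xi' (killed_by n).
    apply: exhaust; [exact: killed_by_char| |exact: killed_by_cover].
    by move=> p q pq x; exact: mulrn_pow2_le.
  (* [killed_by 0] is already the zero subgroup, so a constant sequence suffices. *)
  apply: (@degenerate_of_concentrated _ _ _ _ _ _ (fun=> killed_by 0)).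
  + by move=> _; exact: killed_by_char.
  + by move=> x /(_ 0%N).
  + by move=> _; exact: (killed_by_descent Qc cn).
- apply: (@degenerate_of_concentrated _ _ _ _ _ _ multiples).
  + exact: multiples_char.
  + exact: multiples_inter.
  + by move=> n; exact: (multiples_descent n Qc QT).
Qed.
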